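(* Let $\emptyset\neq\mathcal{A}\subseteq\mathbb{Q}^n$ and $\mathcal{B}\subseteq\mathbb{N}^n\setminus(2\mathbb{N})^n$ be finite and disjoint. A function $f\in\mathbb{R}[\mathcal{A},\mathcal{B}]$ with coefficient vector $\mathbf{c}\in\mathbb{R}^{\mathcal{A}\cup\mathcal{B}}$ is contained in the rational $\mathcal{S}$-cone $C_{\mathcal{S}}(\mathcal{A},\mathcal{B})$ if and only if there exist vectors $\mathbf{c}^{A,\beta}\in\mathbb{R}^{\mathcal{A}\cup\mathcal{B}}$ for $(A,\beta)\in R(\mathcal{A},\mathcal{A}\cup\mathcal{B})$, with $c^{A,\beta}_\gamma=0$ for $\gamma\notin A\cup\{\beta\}$ and $$\mathbf{c}=\sum_{(A,\beta)\in R(\mathcal{A},\mathcal{A}\cup\mathcal{B})}\mathbf{c}^{A,\beta},$$ and a circuit vector $\mathbf{x}^{\mathcal{A},\mathcal{B}}$, consisting of real numbers $x^{A,\beta}_\beta$, $x^{A,\beta}_{k,i}$ ($k\in[m_{A,\beta}]$, $i\in[2^{m_{A,\beta}-k}]$) for $(A,\beta)\in R(\mathcal{A},\mathcal{A}\cup\mathcal{B})$, such that for every $(A,\beta)\in R(\mathcal{A},\mathcal{A}\cup\mathcal{B})$ (with $m=m_{A,\beta}$, $p=p_{A,\beta}$, $\Lambda=\Lambda_{A,\beta}$) the following hold: (1) $\begin{pmatrix} x^{A,\beta}_{k-1,2i-1} & x^{A,\beta}_{k,i} \\ x^{A,\beta}_{k,i} & x^{A,\beta}_{k-1,2i} \end{pmatrix}\succeq0$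 for $2\le k\le m$, $i\in[2^{m-k}]$; (2) $x^{A,\beta}_{m,1}-\Lambda\,x^{A,\beta}_\beta\ge0$; (3) $x^{A,\beta}_\beta+c^{A,\beta}_\beta\ge0$; (4) $\|c^{A,\beta}_\beta\|_2\le x^{A,\beta}_\beta$ (that is, $|c^{A,\beta}_\beta|\le x^{A,\beta}_\beta$) if $(A,\beta)$ is an odd circuit, i.e. $(A,\beta)\in R(\mathcal{A},\mathcal{B})$; (5) in both the even and the odd case, $\begin{pmatrix} u & x^{A,\beta}_{1,l} \\ x^{A,\beta}_{1,l} & w \end{pmatrix}\succeq0$ for $l\in[2^{m-1}]$ and $u,w\in\{c^{A,\beta}_\alpha:\alpha\in A\}\cup\{\Lambda\,x^{A,\beta}_\beta\}$, such that over all these blocks $c^{A,\beta}_\alpha$ appears $(p_{A,\beta})_\alpha$ times for every $\alpha\in A$ and $\Lambda\,x^{A,\beta}_\beta$ appears $2^m-p$ times.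
   Context: $\mathbb{N}=\{0,1,2,\dots\}$, $[r]=\{1,\dots,r\}$, $\succeq 0$ means positive semidefinite. In (5), the order of appearance does not matter. $\mathcal{S}$-cone: let $\mathbb{R}[\mathcal{A},\mathcal{B}]$ be the space of functions $f(\mathbf{x})=\sum_{\alpha\in\mathcal{A}}c_\alpha|\mathbf{x}|^\alpha+\sum_{\beta\in\mathcal{B}}c_\beta\mathbf{x}^\beta$ with real coefficients, where $|\mathbf{x}|^\alpha=\prod_j|x_j|^{\alpha_j}$ (set to $\infty$ if some $x_j=0$ has negative exponent), $\mathbf{x}^\beta=\prod_jx_j^{\beta_j}$. $f$ is an even AG function if at most one $c_\alpha$ ($\alpha\in\mathcal{A}$) is negative and all $c_\beta$ ($\beta\in\mathcal{B}$) are zero; an odd AG function if all $c_\alpha$ ($\alpha\in\mathcal{A}$) are non-negative and at most one $c_\beta$ ($\beta\in\mathcal{B}$) is nonzero; an AG function if it is one of these. $C_{\mathcal{S}}(\mathcal{A},\mathcal{B})$ is the conic hull of all AG functions in $\mathbb{R}[\mathcal{A},\mathcal{B}]$ that are non-negative on $\mathbb{R}^n$; it is called rational if $\mathcal{A}\subseteq\mathbb{Q}^n$. Reduced circuits: for finite $\mathcal{C}\subseteq\mathbb{R}^n$, $R(\mathcal{A},\mathcal{C})$ is the set of pairs $(A,\beta)$ with $A\subseteq\mathcal{A}$ affinely independent, $\beta\in\operatorname{relint}(\operatorname{conv}A)\cap(\mathcal{C}\setminus A)$ and $(\mathcal{A}\cap\operatorname{conv}A)\setminus(A\cup\{\beta\})=\emptyset$.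 Elements of $R(\mathcal{A},\mathcal{A})$ are even, those of $R(\mathcal{A},\mathcal{B})$ are odd reduced circuits. For such a circuit let $\lambda_\alpha>0$ ($\alpha\in A$) be the unique barycentric coordinates, $\sum_{\alpha\in A}\lambda_\alpha\alpha=\beta$, $\sum_{\alpha\in A}\lambda_\alpha=1$; they are rational, and we write $\lambda_\alpha=(p_{A,\beta})_\alpha/p_{A,\beta}$ with $(p_{A,\beta})_\alpha,p_{A,\beta}\in\mathbb{N}$ and $p_{A,\beta}$ minimal; $m_{A,\beta}=\lceil\log_2p_{A,\beta}\rceil$ and $\Lambda_{A,\beta}=\prod_{\alpha\in A}\lambda_\alpha^{\lambda_\alpha}$.
   Formalization: At each α in 𝒜 that lies in no reduced circuit (neither in A nor equal to β), the equation c = Σ c^{A,β} is replaced by c_α ≥ 0, because the printed claim fails there, e.g. for 𝒜={0}, ℬ=∅, f=1. *)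

(* Defs.v *)
From HB Require Import structures.
From mathcomp Require Import all_boot all_order all_algebra finmap.
From mathcomp Require Import all_classical all_reals all_analysis.

Set Implicit Arguments.
Unset Strict Implicit.
Unset Printing Implicit Defensive.

Import Order.TTheory GRing.Theory Num.Theory.
Import numFieldNormedType.Exports.

Local Open Scope classical_set_scope.
Local Open Scope ring_scope.

(* Exponents are row vectors in R^n; finite exponent sets are {fset 'rV[R]_n}. *)

Definition rational_exponent (R : realType) (n : nat) (a : 'rV[R]_n) : Prop :=
  forall j, exists r : rat, a 0 j = ratr r.

Definition natural_exponent (R : realType) (n : nat) (b : 'rV[R]_n) : Prop :=
  forall j, exists k : nat, b 0 j = k%:R.

Definition even_exponent (R : realType) (n : nat) (b : 'rV[R]_n) : Prop :=
  forall j, exists k : nat, b 0 j = (2 * k)%:R.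

(* Note that 0 `^ 0 = 1 in the finite case. *)
Definition abs_monomial (R : realType) (n : nat) (x a : 'rV[R]_n) : \bar R :=
  if [exists j, (x 0 j == 0) && (a 0 j < 0)] then +oo%E
  else (\prod_j `|x 0 j| `^ a 0 j)%:E.

(* Only used for exponents b in N^n, where truncn is exact. *)
Definition monomial (R : realType) (n : nat) (x b : 'rV[R]_n) : R :=
  \prod_j x 0 j ^+ Num.truncn (b 0 j).

(* Vectors in R^S, for a finite set S of exponents, are functions on all
   exponents that vanish off S. *)
Definition supported (R : realType) (n : nat) (S : {fset 'rV[R]_n})
    (c : 'rV[R]_n -> R) : Prop :=
  forall g, g \notin S -> c g = 0.

(* The function of R[A, B] with coefficient vector c. The sums are taken in
   the dual addition of \bar R, in which +oo - oo = +oo; moreover 0 * +oo = 0.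
   The other convention +oo - oo = -oo would make, for example,
   |x|^-2 - |x|^-1 + 1, which is at least 3/4 off 0, fail to be
   nonnegative. *)
Definition signomial (R : realType) (n : nat) (A B : {fset 'rV[R]_n})
    (c : 'rV[R]_n -> R) (x : 'rV[R]_n) : \bar R :=
  (\sum_(a <- A) (c a)%:E * abs_monomial x a +
   \sum_(b <- B) (c b * monomial x b)%:E)%dE.

Definition even_AG (R : realType) (n : nat) (A B : {fset 'rV[R]_n})
    (c : 'rV[R]_n -> R) : Prop :=
  (forall a a', a \in A -> a' \in A -> c a < 0 -> c a' < 0 -> a = a') /\
  (forall b, b \in B -> c b = 0).

Definition odd_AG (R : realType) (n : nat) (A B : {fset 'rV[R]_n})
    (c : 'rV[R]_n -> R) : Prop :=
  (forall a, a \in A -> 0 <= c a) /\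
  (forall b b', b \in B -> b' \in B -> c b != 0 -> c b' != 0 -> b = b').

Definition nonneg_AG (R : realType) (n : nat) (A B : {fset 'rV[R]_n}) :
    set ('rV[R]_n -> R) :=
  [set c | [/\ supported (A `|` B)%fset c, even_AG A B c \/ odd_AG A B c &
               forall x, (0 <= signomial A B c x)%E]].

Definition conic_hull (R : realType) (V : lmodType R) (G : set V) : set V :=
  [set v | exists (k : nat) (t : 'I_k -> R) (g : 'I_k -> V),
     (forall i, 0 <= t i /\ G (g i)) /\ v = \sum_i t i *: g i].

(* The functions |x|^a (a in A) and x^b (b in B) are linearly independent when
   A and B are disjoint, so that elements of R[A, B] are identified with their
   coefficient vectors. *)
Definition S_cone (R : realType) (n : nat) (A B : {fset 'rV[R]_n}) :
    set ('rV[R]_n -> R) :=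
  conic_hull (nonneg_AG A B).

Definition affine_hull (R : realType) (V : lmodType R) (S : set V) : set V :=
  [set v | exists (k : nat) (t : 'I_k -> R) (s : 'I_k -> V),
     [/\ forall i, S (s i), \sum_i t i = 1 & v = \sum_i t i *: s i]].

Definition convex_hull (R : realType) (V : lmodType R) (S : set V) : set V :=
  [set v | exists (k : nat) (t : 'I_k -> R) (s : 'I_k -> V),
     [/\ forall i, 0 <= t i /\ S (s i), \sum_i t i = 1 &
         v = \sum_i t i *: s i]].

Definition relint (R : realType) (n : nat) (S : set 'rV[R]_n) :
    set 'rV[R]_n :=
  [set v | S v /\ \forall w \near v, affine_hull S w -> S w].

Definition affinely_independent (R : realType) (n : nat)
    (A : {fset 'rV[R]_n}) : Prop :=
  forall t : 'rV[R]_n -> R,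
    \sum_(a <- A) t a = 0 -> \sum_(a <- A) t a *: a = 0 ->
    forall a, a \in A -> t a = 0.

Definition circuit (R : realType) (n : nat) : Type :=
  ({fset 'rV[R]_n} * 'rV[R]_n)%type.

Definition is_reduced_circuit (R : realType) (n : nat)
    (A C : {fset 'rV[R]_n}) (q : circuit R n) : Prop :=
  [/\ (q.1 `<=` A)%fset, affinely_independent q.1,
      relint (convex_hull [set` q.1]) q.2,
      q.2 \in (C `\` q.1)%fset &
      forall g, g \in A -> convex_hull [set` q.1] g ->
        g \in (q.2 |` q.1)%fset].

Definition reduced_circuits (R : realType) (n : nat)
    (A C : {fset 'rV[R]_n}) : {fset circuit R n} :=
  [fset q in (fpowerset A `*` C)%fset | `[< is_reduced_circuit A C q >]]%fset.

(* Elements of A that occur in no reduced circuit. A circuit never has just one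
   vertex, so a monomial c_a |x|^a with such an a and c_a > 0 lies in the cone
   but is not a sum of functions supported on circuits; this already happens
   for A = {0}, B = {}. *)
Definition uncovered (R : realType) (n : nat) (A B : {fset 'rV[R]_n}) :
    {fset 'rV[R]_n} :=
  [fset a in A | all (fun q => a \notin (q.2 |` q.1)%fset)
                     (reduced_circuits A (A `|` B)%fset)]%fset.

Definition is_bary (R : realType) (n : nat) (q : circuit R n)
    (t : 'rV[R]_n -> R) : Prop :=
  [/\ supported q.1 t, \sum_(a <- q.1) t a = 1 &
      \sum_(a <- q.1) t a *: a = q.2].

(* The choice operators below pick the unique object with the given property;
   the default values are irrelevant for circuits with rational exponents. *)
Definition bary (R : realType) (n : nat) (q : circuit R n) : 'rV[R]_n -> R :=
  xget (fun=> 0) (is_bary q).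

Definition is_denom (R : realType) (n : nat) (q : circuit R n) (p : nat) :
    Prop :=
  (0 < p)%N /\
  forall a, a \in q.1 -> exists k : nat, bary q a = k%:R / p%:R.

Definition denom (R : realType) (n : nat) (q : circuit R n) : nat :=
  xget 1%N [set p | is_denom q p /\ forall r, is_denom q r -> (p <= r)%N].

Definition numer (R : realType) (n : nat) (q : circuit R n) (a : 'rV[R]_n) :
    nat :=
  xget 0%N [set k | bary q a = k%:R / (denom q)%:R].

(* up_log 2 p is the least m with p <= 2 ^ m. *)
Definition depth (R : realType) (n : nat) (q : circuit R n) : nat :=
  up_log 2 (denom q).

Definition Lambda (R : realType) (n : nat) (q : circuit R n) : R :=
  \prod_(a <- q.1) bary q a `^ bary q a.

Definition psd (R : realType) (k : nat) (M : 'M[R]_k) : Prop :=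
  M^T = M /\ forall v : 'cV[R]_k, 0 <= (v^T *m M *m v) 0 0.

Definition sym2 (R : realType) (u v w : R) : 'M[R]_2 :=
  \matrix_(i, j) if i == j then (if i == 0 then u else w) else v.

(* Labels for the 2 ^ m diagonal entries of the blocks: Some a stands for the
   coefficient c_a, None for Lambda x_b. *)
Definition labels (R : realType) (n : nat) (q : circuit R n) :
    seq (option 'rV[R]_n) :=
  flatten [seq nseq (numer q a) (Some a) | a <- q.1] ++
  nseq (2 ^ depth q - denom q) None.

Definition label_value (R : realType) (n : nat) (q : circuit R n)
    (c : 'rV[R]_n -> R) (xb : R) (o : option 'rV[R]_n) : R :=
  if o is Some a then c a else Lambda q * xb.

(* Main.v *)
Require Import Defs.
From mathcomp Require Import all_boot all_order all_algebra finmap.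
From mathcomp Require Import all_classical all_reals all_analysis.
From mathcomp Require Import ring lra.

Set Implicit Arguments.
Unset Strict Implicit.
Unset Printing Implicit Defensive.

Import Order.TTheory GRing.Theory Num.Theory.
Import numFieldNormedType.Exports.
Local Open Scope ring_scope.

(* If f = sum_a c_a |x|^a + c_b x^b is a nonnegative AG function, choosing signs
   and substituting |x| = e^y gives |c_b| <= sum_a c_a e^<y, a - b> for all y.
   Minimising the right-hand side with a small quadratic penalty and letting the
   penalty tend to 0 yields weights u_a >= 0 with sum_a u_a (a - b) = 0 and
   |c_b| <= sum_a u_a (1 + ln (c_a / u_a)).  By Caratheodory's theorem u is a
     sum
   of weighted barycentric coordinates t of b in simplices; distributing c_a
   proportionally to u_a splits f into circuit functions, because the bound is
   additive and t-weighted logarithms are dominated by their exponential.  On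
     one
   simplex the logarithms of the coefficients extend to an affine function, so
   decomposing into reduced circuits becomes the linear problem of writing
   t - delta_b as a nonnegative combination of the vectors bary q - delta_q.2.
   It is solved by exchanging a vertex for a superfluous point g, which strictly
   decreases the number of points of A in the hull; if the relation of g has the
   same hull, exchanging back gives a contraction that can be inverted.

   For a single circuit, the 2 x 2 blocks form a binary tree of geometric means:
   they say (Lambda x_b)^p <= prod_a c_a^p_a, which is the circuit inequality,
   and it implies nonnegativity by the weighted AM-GM inequality. *)

(** * Affine geometry of exponents *)

Section AffineGeometry.
Variables (R : realType) (n : nat).
Implicit Types (A S : {fset 'rV[R]_n}) (a g v : 'rV[R]_n) (t : 'rV[R]_n -> R).

Definition dot (y a : 'rV[R]_n) : R := \sum_j y 0 j * a 0 j.

Lemma dotDr y a g : dot y (a + g) = dot y a + dot y g.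
Proof. by rewrite -big_split; apply: eq_bigr => j _; rewrite mxE mulrDr. Qed.

Lemma dotNr y a : dot y (- a) = - dot y a.
Proof. by rewrite -sumrN; apply: eq_bigr => j _; rewrite mxE mulrN. Qed.

Lemma dotZr y k a : dot y (k *: a) = k * dot y a.
Proof. by rewrite mulr_sumr; apply: eq_bigr => j _; rewrite mxE mulrCA. Qed.

Lemma dot0r y : dot y 0 = 0.
Proof. by apply: big1 => j _; rewrite mxE mulr0. Qed.

Lemma dot_sumr (I : Type) (r : seq I) (P : pred I) y (F : I -> 'rV[R]_n) :
  dot y (\sum_(i <- r | P i) F i) = \sum_(i <- r | P i) dot y (F i).
Proof. exact: (big_morph _ (dotDr y) (dot0r y)). Qed.

Lemma sum_fset_ord (V : nmodType) A (F : 'rV[R]_n -> V) :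
  \sum_(a <- A) F a = \sum_(i < size A) F A`_i.
Proof. by rewrite (big_nth 0) big_mkord. Qed.

(** Rows [(a, 1)]: affine relations between exponents become linear relations between rows. *)
Definition homogenization A : 'M[R]_(size A, n + 1) :=
  \matrix_i row_mx A`_i 1.

Lemma mul_homogenization A t :
  (\row_(i < size A) t A`_i) *m homogenization A =
  row_mx (\sum_(a <- A) t a *: a) (\sum_(a <- A) t a)%:M.
Proof.
rewrite mulmx_sum_row; apply/rowP => j; rewrite summxE -[j]splitK.
case: (fintype.split j) => k /=.
- rewrite row_mxEl sum_fset_ord summxE; apply: eq_bigr => i _.
  by rewrite !mxE (unsplitK (inl k)).
- rewrite row_mxEr [k]ord1 mxE eqxx mulr1n sum_fset_ord; apply: eq_bigr => i _.
  by rewrite !mxE (unsplitK (inr 0)) mxE mulr1.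
Qed.

Lemma row_nth_fset A (w : 'rV[R]_(size A)) :
  exists t, w = \row_(i < size A) t A`_i.
Proof.
exists (fun a => if insub (index a A) is Some i then w 0 i else 0).
apply/rowP => i; rewrite mxE index_uniq ?fset_uniq //.
by rewrite insubT // => hi; congr (w 0 _); apply: val_inj.
Qed.

Lemma homogenization_free A :
  affinely_independent A -> row_free (homogenization A).
Proof.
move=> iA; apply: inj_row_free => w; have [t ->] := row_nth_fset w.
rewrite mul_homogenization => /eqP; rewrite -row_mx0.
move=> /eqP/eq_row_mx[e1 /matrixP/(_ 0 0)]; rewrite !mxE eqxx mulr1n => e2.
by apply/rowP => i; rewrite !mxE iA ?mem_nth.
Qed.

(** Free rows give the homogenized matrix a right inverse; applied to the column of prescribed
    values, it yields the slope [y] and the constant term [r]. *)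
Lemma affine_interpolation A t : affinely_independent A ->
  exists y r, forall a, a \in A -> dot y a + r = t a.
Proof.
move=> /homogenization_free/row_freeP[X hX].
pose u := X *m \col_(i < size A) t A`_i.
exists (usubmx u)^T, (dsubmx u 0 0) => a aA.
have ia : (index a A < size A)%N by rewrite index_mem.
have : homogenization A *m u = \col_(i < size A) t A`_i by rewrite mulmxA hX
  mul1mx.
move=> /matrixP/(_ (Ordinal ia) 0); rewrite [in RHS]mxE /= nth_index // => <-.
have -> : (homogenization A *m u) (Ordinal ia) 0 =
    (row_mx a 1 *m col_mx (usubmx u) (dsubmx u)) 0 0.
  rewrite vsubmxK [LHS]mxE [RHS]mxE; apply: eq_bigr => j _.
  by rewrite [homogenization _ _ _]mxE /= nth_index.
rewrite mul_row_col mul1mx [RHS]mxE [in RHS]mxE; congr (_ + _).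
by apply: eq_bigr => j _; rewrite mxE mulrC.
Qed.

Lemma bary_unique A t s : affinely_independent A ->
  \sum_(a <- A) t a = \sum_(a <- A) s a ->
  \sum_(a <- A) t a *: a = \sum_(a <- A) s a *: a ->
  forall a, a \in A -> t a = s a.
Proof.
move=> iA e1 e2 a aA; apply/eqP; rewrite -subr_eq0; apply/eqP.
apply: (iA (fun a => t a - s a)) => //.
  by rewrite sumrB e1 subrr.
by under eq_bigr do rewrite scalerBl; rewrite sumrB e2 subrr.
Qed.

(** Collects repeated points, so that an indexed combination becomes a weight function on [A]. *)
Lemma sum_group_fset (V : lmodType R) A k (t : 'I_k -> R) (s : 'I_k -> 'rV[R]_n)
    (F : 'rV[R]_n -> V) : (forall i, s i \in A) ->
  \sum_i t i *: F (s i) = \sum_(a <- A) (\sum_(i | s i == a) t i) *: F a.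
Proof.
move=> sA; under [RHS]eq_bigr do rewrite scaler_suml big_mkcond.
rewrite exchange_big /=; apply: eq_bigr => i _.
rewrite (bigD1_seq (s i)) ?fset_uniq //= eqxx big1 ?addr0 //.
by move=> a; rewrite eq_sym => /negbTE->.
Qed.

Lemma convex_hullP A v : convex_hull [set` A] v <->
  exists t, [/\ supported A t, forall a, 0 <= t a, \sum_(a <- A) t a = 1 &
     \sum_(a <- A) t a *: a = v].
Proof.
split=> [[k [t [s [ts t1 ->]]]]|[t [tA t0 t1 <-]]].
- have sA i : s i \in A by case: (ts i).
  exists (fun a => \sum_(i | s i == a) t i); split.
  + move=> a aA; apply: big1 => i /eqP sa; by rewrite -sa sA in aA.
  + by move=> a; apply: sumr_ge0 => i _; case: (ts i).
  + have := @sum_group_fset R^o A k t s (fun=> 1) sA.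
    rewrite -[RHS]/(\sum_(a <- A) _ * 1) -[LHS]/(\sum_i _ * 1).
    by under eq_bigr do rewrite mulr1; under [RHS]eq_bigr do rewrite mulr1;
      rewrite t1.
  + by rewrite (@sum_group_fset _ A k t s id).
- exists (size A), (fun i => t A`_i), (fun i => A`_i); split.
  + by move=> i; split => //=; apply: mem_nth.
  + by rewrite -sum_fset_ord.
  + by rewrite (sum_fset_ord _ (fun a => t a *: a)).
Qed.

Lemma convex_hull_mem A a : a \in A -> convex_hull [set` A] a.
Proof.
move=> aA; exists 1%N, (fun=> 1), (fun=> a); split=> //.
  by rewrite big_ord1.
by rewrite big_ord1 scale1r.
Qed.

Lemma affine_hull_convexP A v : affine_hull (convex_hull [set` A]) v <->
  exists t, \sum_(a <- A) t a = 1 /\ \sum_(a <- A) t a *: a = v.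
Proof.
split=> [[k [t [s [sA t1 ->]]]]|[t [t1 <-]]].
- have /choice[u hu] : forall i, exists u, \sum_(a <- A) u a = 1 /\
      \sum_(a <- A) u a *: a = s i.
    by move=> i; have [u [_ _ u1 us]] := (convex_hullP _ _).1 (sA i); exists u.
  exists (fun a => \sum_i t i * u i a); split.
  + rewrite exchange_big -t1; apply: eq_bigr => i _ /=.
    by rewrite -mulr_sumr (hu i).1 mulr1.
  + under eq_bigr do rewrite scaler_suml.
    rewrite exchange_big; apply: eq_bigr => i _ /=.
    by under eq_bigr do rewrite -scalerA; rewrite -scaler_sumr (hu i).2.
- exists (size A), (fun i => t A`_i), (fun i => A`_i); split.
  + by move=> i; apply/convex_hull_mem/mem_nth.
  + by rewrite -sum_fset_ord.
  + by rewrite (sum_fset_ord _ (fun a => t a *: a)).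
Qed.

Lemma dot_continuous y : continuous (dot y).
Proof.
apply: continuous_big => [|j _]; first exact: add_continuous.
move=> x; apply: (@continuous_comp _ _ _ (fun x : 'rV[R]_n => x 0 j)).
  exact: coord_continuous.
exact: mulrl_continuous.
Qed.

(** Barycentric coordinates are restrictions of affine functions, hence continuous: positive at [v],
    they stay positive at nearby points of the affine hull. *)
Lemma relint_hull A v t : affinely_independent A -> is_bary (A, v) t ->
  (forall a, a \in A -> 0 < t a) -> relint (convex_hull [set` A]) v.
Proof.
move=> iA [/= tA t1 tv] t0; split.
  apply/convex_hullP; exists t; split => // a.
  by have [/t0/ltW//|/tA->] := boolP (a \in A).
have : \forall w \near v, forall i : 'I_(size A), affine_hull (convex_hull
  [set` A]) w ->
    forall s, \sum_(a <- A) s a = 1 -> \sum_(a <- A) s a *: a = w ->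
    0 < s A`_i.
  apply: (@filter_forall _ _ _ (nbhs v)) => i; set a := A`_i;
    have aA : a \in A by apply: mem_nth.
  (* The affine function interpolating the indicator of [a] reads off the coordinate at [a]
     ([E]). *)
  have [y [r yr]] := affine_interpolation (fun b => (b == a)%:R) iA.
  have E s : \sum_(a <- A) s a = 1 ->
      dot y (\sum_(a <- A) s a *: a) + r = s a.
    move=> s1; rewrite dot_sumr -[r]mul1r -s1 mulr_suml -big_split/=.
    rewrite (bigD1_seq a) ?fset_uniq //= dotZr -mulrDr yr // eqxx mulr1.
    rewrite big_seq_cond big1 ?addr0 // => b /andP[bA bneq].
    by rewrite dotZr -mulrDr yr // (negbTE bneq) mulr0.
  have : \forall w \near v, 0 < dot y w + r.
    have : \forall z \near dot y v, - r < z.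
      by apply: lt_nbhsr; rewrite -subr_gt0 opprK -tv E ?t0.
    move=> /(@dot_continuous y v); rewrite /= nbhs_filterE.
    by apply: (@filterS _ (nbhs v)) => w /=; rewrite -subr_gt0 opprK.
  by apply: (@filterS _ (nbhs v)) => w w0 _ s s1 sw; rewrite -(E _ s1) sw.
apply: (@filterS _ (nbhs v)) => w hw Aw;
  have [s [s1 sw]] := (affine_hull_convexP _ _).1 Aw.
apply/convex_hullP; exists (fun a => if a \in A then s a else 0); split.
- by move=> a /negbTE->.
- move=> a; case: ifP => // aA.
  have ia : (index a A < size A)%N by rewrite index_mem.
  by have /ltW := hw (Ordinal ia) Aw s s1 sw; rewrite /= nth_index.
- by rewrite -s1; apply: eq_big_seq => a ->.
- by rewrite -sw; apply: eq_big_seq => a ->.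
Qed.

(** If the coordinate at [a] were 0, moving [v] slightly away from [a] would stay in the affine hull
    but make this coordinate negative, so the point would leave the hull. *)
Lemma relint_hull_gt0 A v t : affinely_independent A ->
  relint (convex_hull [set` A]) v -> is_bary (A, v) t ->
  forall a, a \in A -> 0 < t a.
Proof.
move=> iA [/convex_hullP[s [sA s0 s1 sv]] hv] [/= tA t1 tv] a aA.
have st b : b \in A -> t b = s b.
  by apply: bary_unique => //; rewrite ?t1 ?s1 ?tv ?sv.
rewrite lt0r st // s0 andbT; apply: contraT; rewrite negbK => /eqP sa0.
have c : continuous (fun e : R => v + e *: (v - a)).
  move=> e; apply: cvgD; first exact: cvg_cst.
  by apply: cvgZl; exact: cvg_id.
have /= := c 0; rewrite /continuous_at scale0r addr0 => /(_ _ hv).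
rewrite /= nbhs_filterE => /nbhs_ballP[e /= e0 he].
have e20 : 0 < e / 2 by rewrite divr_gt0.
pose r b := (1 + e / 2) * s b - e / 2 * (b == a)%:R.
have sr : \sum_(b <- A) r b = 1.
  rewrite sumrB -!mulr_sumr s1 (bigD1_seq a) ?fset_uniq//= eqxx.
  by rewrite big1 ?addr0 => [|b /negbTE->//]; rewrite !mulr1 addrK.
have srv : \sum_(b <- A) r b *: b = v + (e / 2) *: (v - a).
  under eq_bigr do rewrite scalerBl -scalerA -[(e / 2 * _) *: _]scalerA.
  rewrite sumrB -!scaler_sumr sv (bigD1_seq a) ?fset_uniq//= eqxx scale1r.
  rewrite big1 ?addr0 => [|b /negbTE->//]; last by rewrite scale0r.
  by rewrite scalerBr addrA scalerDl scale1r.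
have /convex_hullP[u [uA u0 u1 uv]] : convex_hull [set` A] (v + (e / 2) *: (v -
  a)).
  apply: he; last by apply/affine_hull_convexP; exists r.
  by rewrite /ball/= sub0r normrN gtr0_norm // ltr_pdivrMr // ltr_pMr // ltr1n.
have /(_ a aA) : forall b, b \in A -> u b = r b.
  by apply: bary_unique => //; rewrite ?u1 ?sr ?uv ?srv.
rewrite /r sa0 eqxx mulr0 sub0r mulr1 => ua; move: (u0 a); rewrite ua.
by rewrite oppr_ge0 leNgt e20.
Qed.

End AffineGeometry.

(** * Barycentric coordinates of reduced circuits *)

Section Circuits.
Variables (R : realType) (n : nat).
Implicit Types (A C : {fset 'rV[R]_n}) (a v : 'rV[R]_n) (t : 'rV[R]_n -> R).
Implicit Types q : circuit R n.

Lemma rational_exponentP a : rational_exponent a ->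
  exists w : 'rV[rat]_n, a = map_mx ratr w.
Proof.
move=> /choice[f hf]; exists (\row_j f j).
by apply/rowP => j; rewrite !mxE hf.
Qed.

Lemma natural_rational a : natural_exponent a -> rational_exponent a.
Proof. by move=> ha j; have [k ->] := ha j; exists k%:R; rewrite ratr_nat. Qed.

(** The coordinates solve a linear system with rational entries. Solvability does not change under
    field extension, so a rational solution exists, and by freeness of the rows it is [t]. *)
Lemma bary_rational A v t : affinely_independent A ->
  (forall a, a \in A -> rational_exponent a) -> rational_exponent v ->
  is_bary (A, v) t -> forall a, a \in A -> exists r : rat, t a = ratr r.
Proof.
move=> iA Aq /rational_exponentP[wv ev] [/= _ t1 tv].
have /choice[w hw] : forall i : 'I_(size A), exists w : 'rV[rat]_n,
    A`_i = map_mx ratr w.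
  by move=> i; apply/rational_exponentP/Aq/mem_nth.
pose M : 'M[rat]_(size A, n + 1) := \matrix_i row_mx (w i) 1.
have eM : homogenization A = map_mx ratr M.
  apply/row_matrixP => i; rewrite rowK -map_row rowK map_row_mx -hw.
  by rewrite map_scalar_mx /= rmorph1.
have eD : map_mx ratr (row_mx wv 1) =
    (\row_(i < size A) t A`_i) *m homogenization A :> 'rV[R]_(n + 1).
  by rewrite mul_homogenization t1 tv map_row_mx -ev map_scalar_mx /= rmorph1.
have /submxP[D eDM] : (row_mx wv 1 <= M)%MS.
  by rewrite -(map_submx (ratr : {rmorphism rat -> R})) eD -eM submxMl.
have /(row_free_inj (homogenization_free iA)) e : (\row_(i < size A) t A`_i) *m
  homogenization A
    = map_mx ratr D *m homogenization A.
  by rewrite -eD eDM map_mxM eM.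
move=> a aA; have ia : (index a A < size A)%N by rewrite index_mem.
move/rowP/(_ (Ordinal ia)): e; rewrite !mxE /= nth_index // => ->.
by exists (D 0 (Ordinal ia)).
Qed.

Lemma common_denominator A t : (forall a, a \in A -> 0 <= t a) ->
  (forall a, a \in A -> exists r : rat, t a = ratr r) ->
  exists2 p, (0 < p)%N & forall a, a \in A -> exists k : nat, t a = k%:R / p%:R.
Proof.
move=> t0 tq.
have H (s : seq 'rV[R]_n) : {subset s <= A} -> exists2 p, (0 < p)%N &
    forall a, a \in s -> exists k : nat, t a = k%:R / p%:R.
  elim: s => [_|a s IH sA]; first by exists 1%N.
  have [|p p0 hp] := IH; first by move=> b bs; apply: sA; rewrite inE bs orbT.
  have aA : a \in A by apply: sA; rewrite mem_head.
  have [r tr] := tq a aA.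
  have r0 : 0 <= r by rewrite -(ler0q R) -tr t0.
  pose d := `|denq r|%N; pose k := `|numq r|%N.
  have d0 : (0 < d)%N by rewrite absz_gt0 denq_eq0.
  have tad : t a = k%:R / d%:R.
    rewrite tr /ratr /k /d !natr_absz (gtr0_norm (denq_gt0 r)).
    by rewrite ger0_norm // numq_ge0.
  have pR : p%:R != 0 :> R by rewrite pnatr_eq0 -lt0n.
  have dR : d%:R != 0 :> R by rewrite pnatr_eq0 -lt0n.
  exists (d * p)%N; first by rewrite muln_gt0 d0.
  move=> b; rewrite inE => /orP[/eqP->|/hp[l ->]].
    by exists (k * p)%N; rewrite tad !natrM; field; rewrite pR.
  by exists (l * d)%N; rewrite !natrM; field; rewrite pR.
by apply: H.
Qed.

Lemma reduced_circuitsP A C q :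
  q \in reduced_circuits A C <-> is_reduced_circuit A C q.
Proof.
rewrite !inE /=; split=> [/andP[_ /asboolP//]|h].
apply/andP; split; last exact/asboolP.
case: h => qA _ _; rewrite in_fsetD => /andP[_ qC] _.
by rewrite fpowersetE qA qC.
Qed.

Lemma is_bary_bary q : affinely_independent q.1 -> forall t, is_bary q t ->
  bary q = t.
Proof.
move=> iq t ht; have hb : is_bary q (bary q) by apply: (xgetI (fun=> 0) ht).
case: hb ht => [b0 b1 bv] [t0 t1 tv]; apply/funext => a.
have [aq|aq] := boolP (a \in q.1); last by rewrite b0 // t0.
by apply: (bary_unique iq) aq; rewrite ?b1 ?t1 ?bv ?tv.
Qed.

Lemma reduced_is_bary A C q : is_reduced_circuit A C q -> is_bary q (bary q).
Proof.
case=> _ iq [/convex_hullP[t [tq _ t1 tv]] _] _ _.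
have ht : is_bary q t by [].
by rewrite (is_bary_bary iq ht).
Qed.

Lemma reduced_bary_gt0 A C q a : is_reduced_circuit A C q -> a \in q.1 ->
  0 < bary q a.
Proof.
move=> hq; have := reduced_is_bary hq; case: hq => _ iq rq _ _.
by case: q iq rq => q1 q2 /= iq rq hb; apply: relint_hull_gt0 hb _.
Qed.

Lemma reduced_notin A C q : is_reduced_circuit A C q ->
  [/\ q.2 \notin q.1, q.2 \in C & {subset q.1 <= A}].
Proof. by case=> /fsubsetP h _ _; rewrite inE => /andP[]. Qed.

Variables (A C : {fset 'rV[R]_n}) (q : circuit R n).
Hypotheses (Aq : forall a, a \in A -> rational_exponent a)
  (Cq : forall a, a \in C -> rational_exponent a) (rq : is_reduced_circuit A C
    q).

(** Rational coordinates have a common denominator, hence a least one, so the choice in [denom] does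
    not fall back to its default. *)
Lemma denomP : is_denom q (denom q).
Proof.
have [qq qC qA] := reduced_notin rq.
have [iq hb] : affinely_independent q.1 /\ is_bary q (bary q).
  by split; [case: rq|exact: reduced_is_bary rq].
have [|a aq|p p0 hp] := @common_denominator q.1 (bary q).
- by move=> a aq; apply/ltW/(reduced_bary_gt0 rq aq).
- have hb' : is_bary (q.1, q.2) (bary q) by [].
  apply: (bary_rational iq _ _ hb' aq); last exact: Cq.
  by move=> b bq; apply/Aq/qA.
- have ex : exists r, `[< is_denom q r >] by exists p; apply/asboolP; split.
  have h : is_denom q (ex_minn ex) /\
      forall r, is_denom q r -> (ex_minn ex <= r)%N.
    by case: ex_minnP => m /asboolP hm mmin; split=> // r hr;
      apply/mmin/asboolP.
  by have [] := xgetI 1%N (P := [set p | is_denom q p /\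
    forall r, is_denom q r -> (p <= r)%N]%classic) h.
Qed.

Lemma denom_gt0 : (0 < denom q)%N. Proof. by case: denomP. Qed.

Lemma numerP a : a \in q.1 -> bary q a = (numer q a)%:R / (denom q)%:R.
Proof.
move=> aq; have [_ /(_ _ aq)[k hk]] := denomP.
exact: (xgetI 0%N (P := [set k | bary q a = k%:R / (denom q)%:R]%classic) hk).
Qed.

Lemma numerE a : a \in q.1 -> (numer q a)%:R = (denom q)%:R * bary q a.
Proof.
move=> aq; rewrite numerP // mulrC divfK // pnatr_eq0 -lt0n; exact: denom_gt0.
Qed.

Lemma numer_gt0 a : a \in q.1 -> (0 < numer q a)%N.
Proof.
move=> aq; rewrite -(ltr0n R) numerE // mulr_gt0 ?ltr0n ?denom_gt0 //.
exact: reduced_bary_gt0 rq aq.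
Qed.

Lemma sum_numer : (\sum_(a <- q.1) numer q a = denom q)%N.
Proof.
apply/eqP; rewrite -(eqr_nat R) natr_sum; apply/eqP.
rewrite (eq_big_seq _ numerE) -mulr_sumr.
by have [_ -> _] := reduced_is_bary rq; rewrite mulr1.
Qed.

(** With denominator 1 the positive numerators would sum to 1, leaving at most one vertex; but then
    [q.2] would be that vertex. Consequently the depth is positive and every tree has at least one
    level of blocks. *)
Lemma denom_gt1 : (1 < denom q)%N.
Proof.
rewrite ltn_neqAle denom_gt0 andbT; apply/eqP => d1.
have [qq _ _] := reduced_notin rq; have [_ b1 bv] := reduced_is_bary rq.
have : (#|` q.1| <= 1)%N.
  rewrite [leqRHS]d1 -sum_numer -sum1_size big_seq [leqRHS]big_seq.
  by apply: leq_sum => a; exact: numer_gt0.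
rewrite leq_eqVlt ltnS leqn0 => /orP[/cardfs1P[a q1a]|/eqP/cardfs0_eq q10].
  move: b1 bv qq; rewrite q1a !big_seq_fset1 => ->; rewrite scale1r => <-.
  by rewrite in_fset1 eqxx.
by move: b1; rewrite q10 big_seq_fset0 => /eqP; rewrite eq_sym oner_eq0.
Qed.

Lemma denom_le_depth : (denom q <= 2 ^ depth q)%N.
Proof. exact: up_logP. Qed.

Lemma depth_gt0 : (0 < depth q)%N.
Proof. by rewrite lt0n up_log_eq0 /= -ltnNge denom_gt1. Qed.

Lemma size_labels : size (labels q) = (2 ^ depth q)%N.
Proof.
rewrite size_cat size_nseq size_flatten /shape -map_comp sumnE big_map.
under eq_bigr do rewrite /= size_nseq.
by rewrite sum_numer subnKC // denom_le_depth.
Qed.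

Lemma Lambda_gt0 : 0 < Lambda q.
Proof.
rewrite /Lambda big_seq; apply: prodr_gt0 => a aq; apply: powR_gt0.
exact: reduced_bary_gt0 rq aq.
Qed.

Lemma prod_labels (c : 'rV[R]_n -> R) xb :
  \prod_(o <- labels q) label_value q c xb o =
  (\prod_(a <- q.1) c a ^+ numer q a) *
    (Lambda q * xb) ^+ (2 ^ depth q - denom q).
Proof.
rewrite big_cat big_flatten big_map /=; congr (_ * _).
  by apply: eq_bigr => a _; rewrite big_nseq iter_mulr_1.
by rewrite big_nseq iter_mulr_1.
Qed.

Lemma mem_labels a : a \in q.1 -> Some a \in labels q.
Proof.
move=> aq; rewrite mem_cat; apply/orP; left; apply/flatten_mapP; exists a => //.
by rewrite mem_nseq eqxx andbT numer_gt0.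
Qed.

End Circuits.

(** * Trees of 2 x 2 blocks *)

Section SquareRootTrees.
Variable R : realType.

Lemma quad_sym2 (u v w : R) (z : 'cV[R]_2) :
  (z^T *m sym2 u v w *m z) 0 0 =
  u * z 0 0 ^+ 2 + 2 * v * z 0 0 * z 1 0 + w * z 1 0 ^+ 2.
Proof.
rewrite mxE !big_ord_recl big_ord0 !mxE !big_ord_recl !big_ord0 !mxE /=.
have -> : lift ord0 ord0 = 1 :> 'I_2 by apply: val_inj.
by ring.
Qed.

(** The forward direction evaluates the quadratic form at suitable vectors; the backward direction
    completes the square. *)
Lemma psd_sym2 (u v w : R) :
  psd (sym2 u v w) <-> [/\ 0 <= u, 0 <= w & v ^+ 2 <= u * w].
Proof.
split=> [[_ h]|[u0 w0 h]].
- have H x y : 0 <= u * x ^+ 2 + 2 * v * x * y + w * y ^+ 2.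
    have := h (\col_i (if i == 0 then x else y)).
    by rewrite quad_sym2 !mxE.
  have u0 : 0 <= u by have := H 1 0; lra.
  have w0 : 0 <= w by have := H 0 1; lra.
  split=> //; move: u0; rewrite le_eqVlt => /orP[/eqP u0|u0].
    (* For [u = 0] this vector gives the value [- (w + 2) v^4], which forces [v = 0]. *)
    have := H (- (w + 1) * v) (v ^+ 2); rewrite -u0.
    have -> : 0 * (- (w + 1) * v) ^+ 2 + 2 * v * (- (w + 1) * v) * v ^+ 2 +
      w * v ^+ 2 ^+ 2 = - ((w + 2) * (v ^+ 2) ^+ 2) by ring.
    rewrite oppr_ge0 pmulr_rle0 ?ltr_wpDl // mul0r => h4.
    by rewrite le_eqVlt -(sqrf_eq0 (v ^+ 2)) eq_le h4 sqr_ge0.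
  have := H (- v) u.
  have -> : u * (- v) ^+ 2 + 2 * v * - v * u + w * u ^+ 2 = u * (u * w - v ^+ 2)
    by ring.
  by rewrite pmulr_rge0 // subr_ge0.
- split.
    by apply/matrixP => i j; rewrite !mxE eq_sym; case: eqP => // ->.
  move=> z; rewrite quad_sym2; set x := z 0 0; set y := z 1 0.
  move: u0; rewrite le_eqVlt => /orP[/eqP u0|u0].
    have /eqP : v ^+ 2 = 0 by apply/le_anti;
      rewrite sqr_ge0 andbT -[leRHS](mul0r w) u0.
    rewrite sqrf_eq0 => /eqP ->; rewrite -u0.
    by rewrite mulr0 !mul0r !add0r mulr_ge0 ?sqr_ge0.
  rewrite -(pmulr_rge0 _ u0).
  have -> : u * (u * x ^+ 2 + 2 * v * x * y + w * y ^+ 2) =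
    (u * x + v * y) ^+ 2 + (u * w - v ^+ 2) * y ^+ 2 by ring.
  by rewrite addr_ge0 ?sqr_ge0 // mulr_ge0 ?subr_ge0 ?sqr_ge0.
Qed.

Lemma tree_split (F : nat -> R) k i :
  \prod_(i * 2 ^ k.+1 <= j < i.+1 * 2 ^ k.+1) F j =
  (\prod_(i.*2 * 2 ^ k <= j < i.*2.+1 * 2 ^ k) F j) *
  (\prod_(i.*2.+1 * 2 ^ k <= j < i.*2.+2 * 2 ^ k) F j).
Proof.
rewrite -big_cat_nat ?leq_pmul2r ?expn_gt0 //=.
by rewrite expnS !mulnA !muln2 doubleS.
Qed.

(** Induction on the level: squaring a node bounds it by its two children, and the leaves below node
    [i] of level [k] are those from [i 2^k] to [(i+1) 2^k - 1]. Absolute values allow raising to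
    powers whatever the signs of the inner nodes. *)
Lemma tree_le (Y : nat -> nat -> R) m :
  (forall k i, (k < m)%N -> (i < 2 ^ (m - k.+1))%N ->
     Y k.+1 i ^+ 2 <= Y k i.*2 * Y k i.*2.+1) ->
  forall k i, (k <= m)%N -> (i < 2 ^ (m - k))%N ->
  `|Y k i| ^+ (2 ^ k) <= \prod_(i * 2 ^ k <= j < i.+1 * 2 ^ k) `|Y 0%N j|.
Proof.
move=> hY; elim=> [|k IH] i km im.
  by rewrite expn0 !muln1 big_nat1 expr1.
have h2 : (i.*2.+1 < 2 ^ (m - k))%N.
  by rewrite -(subnSK km) expnS mul2n ltn_Sdouble.
rewrite tree_split expnS exprM real_normK ?num_real //.
have /le_trans -> // : (Y k.+1 i ^+ 2) ^+ (2 ^ k) <=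
    (`|Y k i.*2| * `|Y k i.*2.+1|) ^+ (2 ^ k).
  rewrite lerXn2r ?nnegrE ?sqr_ge0 ?mulr_ge0 //.
  by rewrite (le_trans (hY _ _ km im)) // -normrM ler_norm.
rewrite exprMn ler_pM ?exprn_ge0 //; apply: IH => //; try exact: ltnW.
Qed.

(** Each node is the geometric mean of the leaves below it; this is the choice for which all 2 x 2
    blocks are singular. *)
Fixpoint sqrt_tree (L : nat -> R) (k i : nat) : R :=
  if k is k'.+1
  then Num.sqrt (sqrt_tree L k' i.*2 * sqrt_tree L k' i.*2.+1)
  else L i.

Lemma sqrt_tree_ge0 (L : nat -> R) k i :
  (forall j, 0 <= L j) -> 0 <= sqrt_tree L k i.
Proof. by move=> L0; case: k => [|k] //=; exact: sqrtr_ge0. Qed.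

Lemma sqrt_tree_expn (L : nat -> R) k i : (forall j, 0 <= L j) ->
  sqrt_tree L k i ^+ (2 ^ k) = \prod_(i * 2 ^ k <= j < i.+1 * 2 ^ k) L j.
Proof.
move=> L0; elim: k i => [|k IH] i; first by rewrite expn0 !muln1 big_nat1.
rewrite tree_split -!IH expnS exprM /= sqr_sqrtr ?exprMn //.
by rewrite mulr_ge0 ?sqrt_tree_ge0.
Qed.

End SquareRootTrees.

(** * The convex cone of block-representable vectors of one circuit *)

Section CircuitCone.
Variables (R : realType) (n : nat) (A B : {fset 'rV[R]_n}).
Variables (q : circuit R n) (s : seq (option 'rV[R]_n)).
Implicit Types (c : 'rV[R]_n -> R) (x : nat -> nat -> R).

(** The constraints of the theorem for one circuit, with [s] an arrangement of its labels. Blocks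
    are numbered from 1 but list positions from 0, so block [l] uses the positions [2l-2] and
    [2l-1]. *)
Definition circuit_soc c (xb : R) x : Prop :=
  let m := depth q in
  [/\ forall k i : nat, (2 <= k <= m)%N -> (1 <= i <= 2 ^ (m - k))%N ->
        psd (sym2 (x k.-1 (2 * i).-1) (x k i) (x k.-1 (2 * i)%N)),
      0 <= x m 1%N - Lambda q * xb,
      0 <= xb + c q.2,
      q \in reduced_circuits A B -> `|c q.2| <= xb &
      forall l : nat, (1 <= l <= 2 ^ m.-1)%N ->
        psd (sym2 (label_value q c xb (nth None s (2 * l).-2)) (x 1%N l)
                  (label_value q c xb (nth None s (2 * l).-1)))].

Definition circuit_cone c : Prop :=
  supported (q.2 |` q.1)%fset c /\ exists xb x, circuit_soc c xb x.

Lemma circuit_cone0 : circuit_cone (fun=> 0).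
Proof.
split=> //; exists 0, (fun _ _ => 0).
have psd0 : psd (sym2 (0 : R) 0 0) by apply/psd_sym2; rewrite expr0n/= mul0r;
  split.
split=> //; rewrite ?mulr0 ?subr0 ?addr0 ?normr0 //.
by move=> l _; case: nth => [a|]; case: nth => [b|]; rewrite /= ?mulr0.
Qed.

Lemma psdD (u v w u' v' w' : R) : psd (sym2 u v w) -> psd (sym2 u' v' w') ->
  psd (sym2 (u + u') (v + v') (w + w')).
Proof.
have -> : sym2 (u + u') (v + v') (w + w') = sym2 u v w + sym2 u' v' w'.
  by apply/matrixP => i j; rewrite !mxE; case: ifP => // _; case: ifP.
move=> [e1 h1] [e2 h2]; split=> [|z]; first by rewrite linearD/= e1 e2.
by rewrite mulmxDr mulmxDl mxE addr_ge0.
Qed.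

Lemma psdZ (r u v w : R) : 0 <= r -> psd (sym2 u v w) ->
  psd (sym2 (r * u) (r * v) (r * w)).
Proof.
move=> r0 /psd_sym2[u0 w0 h]; apply/psd_sym2; split; rewrite ?mulr_ge0 //.
have -> : r * u * (r * w) = r ^+ 2 * (u * w) by ring.
by rewrite exprMn ler_wpM2l ?sqr_ge0.
Qed.

Lemma label_valueD c c' xb xb' o :
  label_value q (fun g => c g + c' g) (xb + xb') o =
  label_value q c xb o + label_value q c' xb' o.
Proof. by case: o => //=; rewrite mulrDr. Qed.

Lemma label_valueZ r c xb o :
  label_value q (fun g => r * c g) (r * xb) o = r * label_value q c xb o.
Proof. by case: o => //=; rewrite mulrCA. Qed.

(** All constraints are linear matrix inequalities or norm bounds with the same fixed arrangement,
    so feasible auxiliary variables can be added. *)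
Lemma circuit_coneD c c' : circuit_cone c -> circuit_cone c' ->
  circuit_cone (fun g => c g + c' g).
Proof.
move=> [sc [xb [x [h1 h2 h3 h4 h5]]]] [sc' [xb' [x' [h1' h2' h3' h4' h5']]]].
split; first by move=> g gq; rewrite sc ?sc' ?addr0.
exists (xb + xb'), (fun k i => x k i + x' k i); split.
- by move=> k i km im; apply: psdD; [exact: h1|exact: h1'].
- by rewrite mulrDr; lra.
- by lra.
- by move=> hq; rewrite (le_trans (ler_normD _ _)) // lerD ?h4 ?h4'.
- by move=> l hl; rewrite !label_valueD; apply: psdD; [exact: h5|exact: h5'].
Qed.

Lemma circuit_coneZ r c : 0 <= r -> circuit_cone c ->
  circuit_cone (fun g => r * c g).
Proof.
move=> r0 [sc [xb [x [h1 h2 h3 h4 h5]]]].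
split; first by move=> g gq; rewrite sc ?mulr0.
exists (r * xb), (fun k i => r * x k i); split.
- by move=> k i km im; apply: psdZ => //; exact: h1.
- by rewrite mulrCA -mulrBr mulr_ge0.
- by rewrite -mulrDr mulr_ge0.
- by move=> hq; rewrite normrM ger0_norm // ler_wpM2l // h4.
- by move=> l hl; rewrite !label_valueZ; apply: psdZ => //; exact: h5.
Qed.

Hypotheses (Aq : forall a, a \in A -> rational_exponent a)
  (ABq : forall a, a \in (A `|` B)%fset -> rational_exponent a)
  (rq : is_reduced_circuit A (A `|` B)%fset q) (hs : perm_eq s (labels q)).

Let m := depth q.
Let p := denom q.

Lemma geom_mean_expn c : (forall a, a \in q.1 -> 0 <= c a) ->
  (\prod_(a <- q.1) c a `^ bary q a) ^+ p = \prod_(a <- q.1) c a ^+ numer q a.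
Proof.
move=> c0; rewrite -prodrXl; apply: eq_big_seq => a aq.
rewrite -(powR_mulrn p (powR_ge0 _ _)) -powRrM mulrC -(numerE Aq ABq rq) //.
by rewrite powR_mulrn // c0.
Qed.

Lemma size_arr : size s = (2 ^ m)%N.
Proof. by rewrite (perm_size hs) (size_labels Aq ABq rq). Qed.

Lemma prod_arr c xb :
  \prod_(0 <= j < 2 ^ m) label_value q c xb (nth None s j) =
  (\prod_(a <- q.1) c a ^+ numer q a) * (Lambda q * xb) ^+ (2 ^ m - p).
Proof.
by rewrite -prod_labels -(perm_big _ hs) (big_nth None) size_arr.
Qed.

(** Every [c a] occurs as a diagonal entry, hence is nonnegative. With [G] the geometric mean, the
    tree bound reads [(Lambda xb)^(2^m) <= G^p (Lambda xb)^(2^m - p)]; for [xb > 0] one cancels and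
    takes [p]-th roots. *)
Lemma circuit_soc_le c xb x : circuit_soc c xb x ->
  (forall a, a \in q.1 -> 0 <= c a) /\
  (0 < xb -> Lambda q * xb <= \prod_(a <- q.1) c a `^ bary q a).
Proof.
move=> [h1 h2 _ _ h5].
have m0 : (0 < m)%N := depth_gt0 Aq ABq rq.
pose L j := label_value q c xb (nth None s j).
have m2 : (2 ^ m = (2 ^ m.-1).*2)%N by rewrite -(prednK m0) expnS mul2n.
have blk l : (l < 2 ^ m.-1)%N ->
    [/\ 0 <= L l.*2, 0 <= L l.*2.+1 & x 1%N l.+1 ^+ 2 <= L l.*2 * L l.*2.+1].
  move=> lm; have /psd_sym2 : psd (sym2 (L (2 * l.+1).-2) (x 1%N l.+1) (L (2 *
    l.+1).-1)).
    exact: h5.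
  by rewrite mul2n doubleS.
(* Counting blocks from 0, leaf [j] is a diagonal entry of block [j./2], in the place given by its
   parity. *)
have L0 j : (j < 2 ^ m)%N -> 0 <= L j.
  move=> jm; have jh : (j./2 < 2 ^ m.-1)%N.
    by rewrite -ltn_double -m2 (leq_ltn_trans _ jm) // -{2}(odd_double_half j)
      leq_addl.
  have [l0 l1 _] := blk _ jh.
  by rewrite -(odd_double_half j); case: odd.
have c0 a : a \in q.1 -> 0 <= c a.
  move=> aq; have : Some a \in s by rewrite (perm_mem hs) (mem_labels Aq ABq
    rq).
  by move=> /(nthP None)[j jm ja]; have := L0 j; rewrite -size_arr /L ja; apply.
split=> // xb0.
have L1 : 0 < Lambda q * xb by rewrite mulr_gt0 // (Lambda_gt0 rq).
(* A single tree with the labels as level 0 below the levels of [x], with positions shifted to start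
   at 0. *)
pose Y k i := if k is 0 then L i else x k i.+1.
have hY k i : (k < m)%N -> (i < 2 ^ (m - k.+1))%N ->
    Y k.+1 i ^+ 2 <= Y k i.*2 * Y k i.*2.+1.
  case: k => [|k] km im; first by rewrite subn1 in im; case: (blk _ im).
  have /psd_sym2[_ _] := h1 k.+2 i.+1 km im.
  by rewrite mul2n doubleS.
have := tree_le hY (leqnn m) (i := 0); rewrite subnn => /(_ isT).
rewrite mul0n mul1n (eq_big_nat _ _ (F2 := L)); last first.
  by move=> j /andP[_ jm]; rewrite /= ger0_norm // L0.
rewrite prod_arr -geom_mean_expn //.
have xm : Lambda q * xb <= Y m 0%N.
  by move: h2; rewrite /Y -/m; case: (m) m0 => // k _; rewrite subr_ge0.
move=> hm; set G := \prod_(a <- q.1) _.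
have G0 : 0 <= G by rewrite prodr_ge0 // => a _; exact: powR_ge0.
have {}hm : (Lambda q * xb) ^+ (2 ^ m) <= G ^+ p * (Lambda q * xb) ^+ (2 ^ m -
  p).
  apply: le_trans hm; rewrite lerXn2r ?nnegrE ?(ltW L1) //.
  by rewrite (le_trans xm) // ler_norm.
have pm : (p <= 2 ^ m)%N := denom_le_depth q.
move: hm; rewrite -{1}(subnKC pm) exprD ler_pM2r ?exprn_gt0 //.
by rewrite ler_pXn2r ?nnegrE ?(ltW L1) // (denom_gt0 Aq ABq rq).
Qed.

(** The square-root tree over the labels supplies [x]. Its root has [2^m]-th power
    [G^p (Lambda xb)^(2^m - p)] with [G] the geometric mean; as [Lambda xb = G], the padding labels
    do not change the mean and the root is exactly [Lambda xb]. *)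
Lemma circuit_cone_tight c xb : supported (q.2 |` q.1)%fset c ->
  (forall a, a \in q.1 -> 0 <= c a) -> 0 <= xb ->
  Lambda q * xb = \prod_(a <- q.1) c a `^ bary q a -> 0 <= xb + c q.2 ->
  (q \in reduced_circuits A B -> `|c q.2| <= xb) -> circuit_cone c.
Proof.
move=> sc c0 xb0 e h3 h4; split=> //.
pose L j := label_value q c xb (nth None s j).
have m0 : (0 < m)%N := depth_gt0 Aq ABq rq.
have Lx0 : 0 <= Lambda q * xb by rewrite mulr_ge0 // ltW // (Lambda_gt0 rq).
have L0 j : 0 <= L j.
  rewrite /L; case E : (nth None s j) => [a|] //=; apply: c0.
  have : Some a \in labels q.
    rewrite -(perm_mem hs) -E mem_nth // ltnNge; apply/negP => js.
    by rewrite nth_default in E.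
  rewrite mem_cat => /orP[/flatten_mapP[b bq]|];
    last by rewrite mem_nseq => /andP[].
  by rewrite mem_nseq => /andP[_ /eqP[->]].
exists xb, (fun k i => sqrt_tree L k i.-1); split=> //.
- move=> [|[|k]] // [|i] // _ _; apply/psd_sym2; rewrite mul2n doubleS /=.
  by rewrite sqr_sqrtr ?mulr_ge0 ?sqrt_tree_ge0.
- rewrite subr_ge0 /= le_eqVlt; apply/orP; left.
  rewrite eq_sym -(@eqrXn2 _ (2 ^ m)) ?expn_gt0 ?sqrt_tree_ge0 //.
  rewrite sqrt_tree_expn // mul0n mul1n prod_arr -geom_mean_expn // -e.
  by rewrite -exprD subnKC // denom_le_depth.
- move=> [|l] // _; apply/psd_sym2; rewrite mul2n doubleS /=.
  by rewrite sqr_sqrtr ?mulr_ge0 ?L0 //; split;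
    rewrite ?(L0 l.*2) ?(L0 l.*2.+1).
Qed.

(** With [xb] and [x] zero all blocks are diagonal and nonnegative. For an odd circuit, disjointness
    rules out [a = q.2]. *)
Lemma circuit_cone_monomial a r : (A `&` B)%fset = fset0 -> 0 <= r ->
  a \in A -> a \in (q.2 |` q.1)%fset ->
  circuit_cone (fun g => r * (g == a)%:R).
Proof.
move=> AB r0 aA aq.
have c0 g : 0 <= r * (g == a)%:R by rewrite mulr_ge0.
have psd0 u w : 0 <= u -> 0 <= w -> psd (sym2 u 0 w).
  by move=> u0 w0; apply/psd_sym2; split; rewrite ?expr0n ?mulr_ge0.
split; first by move=> g; case: eqP => [->|_ _]; rewrite ?aq ?mulr0.
exists 0, (fun _ _ => 0); split.
- by move=> k i _ _; apply: psd0.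
- by rewrite mulr0 subr0.
- by rewrite add0r.
- move=> /reduced_circuitsP/reduced_notin[_ qB _]; case: eqP => [qa|_].
    by have : a \in (A `&` B)%fset; [rewrite in_fsetI aA -qa|rewrite AB].
  by rewrite mulr0 normr0.
- move=> l _; apply: psd0; case: nth => [b|] /=; rewrite ?mulr0 ?c0 //.
Qed.

End CircuitCone.

(** * Nonnegativity of circuit functions *)

Section CircuitsAreNonnegative.
Variables (R : realType) (n : nat).
Implicit Types (A B S : {fset 'rV[R]_n}) (x a b : 'rV[R]_n).
Implicit Types c t u : 'rV[R]_n -> R.

(** If some [u a] is 0 the product vanishes. Otherwise let [k] be the logarithm of the geometric
    mean; averaging the tangent bound [u a >= e^k (1 + ln (u a) - k)] with weights [t] gives
    [e^k]. *)
Lemma weighted_AM_GM S t u : (forall a, a \in S -> 0 < t a) ->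
  \sum_(a <- S) t a = 1 -> (forall a, a \in S -> 0 <= u a) ->
  \prod_(a <- S) u a `^ t a <= \sum_(a <- S) t a * u a.
Proof.
move=> t0 t1 u0; have [/allP/= uS|] := boolP (all (fun a => u a != 0) S);
  last first.
  move=> /allPn[a aS]; rewrite negbK => /eqP ua.
  rewrite (bigD1_seq a) ?fset_uniq //= ua powR0 ?gt_eqF ?t0 // mul0r.
  by rewrite big_seq sumr_ge0 // => b bS; rewrite mulr_ge0 ?u0 // ltW ?t0.
have {}u0 a : a \in S -> 0 < u a by move=> aS; rewrite lt0r uS ?u0.
set k := \sum_(a <- S) t a * ln (u a).
have -> : \prod_(a <- S) u a `^ t a = expR k.
  rewrite expR_sum; apply: eq_big_seq => a aS.
  by rewrite /powR gt_eqF ?u0.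
have -> : expR k = \sum_(a <- S) t a * (expR k * (1 + (ln (u a) - k))).
  have -> : \sum_(a <- S) t a * (expR k * (1 + (ln (u a) - k))) =
      expR k * ((1 - k) * \sum_(a <- S) t a + \sum_(a <- S) t a * ln (u a)).
    rewrite mulr_sumr -big_split mulr_sumr; apply: eq_bigr => a _ /=; ring.
  by rewrite t1 -/k; ring.
rewrite big_seq [leRHS]big_seq; apply: ler_sum => a aS.
rewrite ler_wpM2l ?(ltW (t0 _ aS)) //.
have {2}-> : u a = expR k * expR (ln (u a) - k).
  by rewrite -expRD addrC subrK lnK // posrE u0.
by rewrite ler_wpM2l ?expR_ge0 ?expR_ge1Dx.
Qed.

(* At a pole this is a junk value, since [0 `^ r = 0] also for [r < 0]. *)
Definition abs_monomial_real x a : R := \prod_j `|x 0 j| `^ a 0 j.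
Definition pole x a : bool := [exists j, (x 0 j == 0) && (a 0 j < 0)].

Lemma abs_monomial_real_ge0 x a : 0 <= abs_monomial_real x a.
Proof. by apply: prodr_ge0 => j _; apply: powR_ge0. Qed.

Lemma powR_prod (I : Type) (r : seq I) (F : I -> R) (e : R) :
  (forall i, 0 <= F i) -> (\prod_(i <- r) F i) `^ e = \prod_(i <- r) F i `^ e.
Proof.
move=> F0; elim: r => [|i r IH]; first by rewrite !big_nil powR1.
by rewrite !big_cons powRM ?IH // prodr_ge0.
Qed.

(** At [y = 0] a power is 1 or 0 according to whether its exponent vanishes; for nonnegative
    exponents with positive weights, the weighted sum vanishes exactly when all of them do. *)
Lemma powR_weighted_sum (s : seq 'rV[R]_n) (y : R) t u :
  (forall a, a \in s -> 0 < t a) ->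
  (y == 0 -> forall a, a \in s -> 0 <= u a) ->
  \prod_(a <- s) (y `^ u a) `^ t a = y `^ (\sum_(a <- s) t a * u a).
Proof.
elim: s => [|a s IH] t0 u0; first by rewrite !big_nil powRr0.
rewrite !big_cons IH; first last.
- by move=> y0 b bs; apply: u0 => //; rewrite inE bs orbT.
- by move=> b bs; apply: t0; rewrite inE bs orbT.
rewrite -powRrM [u a * _]mulrC; move: u0; have [->|y0] := eqVneq y 0 => u0;
  last first.
  by rewrite powRD // y0 implybT.
have u0' := u0 isT; rewrite /powR eqxx -natrM mulnb paddr_eq0 //.
  by rewrite mulr_ge0 ?u0' ?mem_head // ltW // t0 ?mem_head.
rewrite big_seq sumr_ge0 // => b bs.
by rewrite mulr_ge0 ?u0' ?inE ?bs ?orbT // ltW // t0 ?inE ?bs ?orbT.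
Qed.

(** Where [x 0 j = 0], no pole at the vertices means nonnegative [j]-th exponents there, hence also
    at the barycentre [b]. *)
Lemma abs_monomial_real_bary S t x b : (forall a, a \in S -> 0 < t a) ->
  \sum_(a <- S) t a *: a = b -> (forall a, a \in S -> ~~ pole x a) ->
  ~~ pole x b /\
  \prod_(a <- S) abs_monomial_real x a `^ t a = abs_monomial_real x b.
Proof.
move=> t0 <- hS.
have h0 j : `|x 0 j| == 0 -> forall a, a \in S -> 0 <= a 0 j.
  rewrite normr_eq0 => xj a aS; rewrite leNgt; apply/negP => aj.
  by move/negP: (hS _ aS); apply; apply/existsP; exists j; rewrite xj.
split.
  apply/existsP => -[j /andP[xj]];
    rewrite summxE ltNge big_seq sumr_ge0 // => a aS.
  by rewrite mxE mulr_ge0 ?(ltW (t0 _ aS)) ?h0 ?normr_eq0.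
transitivity (\prod_(a <- S) \prod_j (`|x 0 j| `^ a 0 j) `^ t a).
  by apply: eq_bigr => a _; apply: powR_prod => j; exact: powR_ge0.
rewrite exchange_big; apply: eq_bigr => j _ /=.
rewrite powR_weighted_sum //; last exact: h0.
by rewrite summxE; congr (_ `^ _); apply: eq_bigr => a _; rewrite mxE.
Qed.

Lemma normr_monomial x b : natural_exponent b ->
  `|monomial x b| = abs_monomial_real x b.
Proof.
move=> hb; rewrite normr_prod; apply: eq_bigr => j _.
by have [k ->] := hb j; rewrite natrK normrX powR_mulrn.
Qed.

(** A pole at an exponent with coefficient 0 is harmless, since 0 times [+oo] is 0. *)
Lemma signomial_finite A B c x :
  (forall a, a \in A -> c a != 0 -> ~~ pole x a) ->
  signomial A B c x = (\sum_(a <- A) c a * abs_monomial_real x a +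
                       \sum_(b <- B) c b * monomial x b)%:E.
Proof.
move=> h; rewrite /signomial DualAddTheoryNumDomain.dsumEFin
  DualAddTheoryNumDomain.dEFinD; congr (dual_adde _ _).
rewrite -DualAddTheoryNumDomain.dsumEFin; apply: eq_big_seq => a aA.
have [->|ca] := eqVneq (c a) 0; first by rewrite mul0r mul0e.
by rewrite /abs_monomial -/(pole x a) (negbTE (h _ _ _)).
Qed.

(** In the dual addition a single [+oo] absorbs all other summands, even [-oo]. *)
Lemma signomial_pole A B c x a : a \in A -> 0 < c a -> pole x a ->
  signomial A B c x = +oo%E.
Proof.
move=> aA ca xa; rewrite /signomial DualAddTheoryNumDomain.dsumEFin.
have -> : (\sum_(a <- A) (c a)%:E * abs_monomial x a = +oo)%dE.
  apply/DualAddTheoryNumDomain.desum_eqyP; exists a; split=> //.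
  by rewrite /abs_monomial -/(pole x a) xa gt0_muley ?lte_fin.
by [].
Qed.

Variables (A B : {fset 'rV[R]_n}) (q : circuit R n) (s : seq (option 'rV[R]_n)).
Hypotheses (Aq : forall a, a \in A -> rational_exponent a)
  (Bn : forall b, b \in B -> natural_exponent b)
  (AB : (A `&` B)%fset = fset0)
  (rq : is_reduced_circuit A (A `|` B)%fset q) (hs : perm_eq s (labels q)).

Lemma circuit_cone_nonneg_AG c : circuit_cone A B q s c -> nonneg_AG A B c.
Proof.
move=> [sc [xb [x0 hc]]].
have ABq a : a \in (A `|` B)%fset -> rational_exponent a.
  by rewrite in_fsetU => /orP[/Aq//|/Bn/natural_rational].
have [c0 cxb] := circuit_soc_le Aq ABq rq hs hc.
case: hc => _ _ hx hodd _.
have [qq qAB qA] := reduced_notin rq.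
have hb := reduced_is_bary rq; have bary0 := reduced_bary_gt0 rq.
have notB a : a \in A -> a \in B -> False.
  by move=> aA aB; have := in_fset0 a; rewrite -AB in_fsetI aA aB.
have cA a : a \in A -> a != q.2 -> 0 <= c a.
  move=> aA aq; have [/c0//|aq1] := boolP (a \in q.1).
  by rewrite sc // in_fset1U negb_or aq.
have cB b : b \in B -> b != q.2 -> c b = 0.
  move=> bB bq; rewrite sc // in_fset1U negb_or bq; apply/negP => /qA bA.
  exact: (notB b).
split.
- move=> g gAB; apply: sc; rewrite in_fset1U; apply: contra gAB.
  by move=> /orP[/eqP->//|/qA gA]; rewrite in_fsetU gA.
- move: qAB; rewrite in_fsetU => /orP[q2|q2]; [left|right]; split.
  + move=> a a' aA a'A ca ca'.
    have E g : g \in A -> c g < 0 -> g = q.2.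
      by move=> gA; apply: contraTeq => /(cA _ gA); rewrite leNgt.
    by rewrite (E a aA ca) (E a' a'A ca').
  + by move=> b bB; apply: cB => //; apply/eqP => bq; rewrite bq in bB;
    exact: notB bB.
  + by move=> a aA; apply: cA => //; apply/eqP => aq; rewrite aq in aA;
    exact: notB q2.
  + move=> b b' bB b'B cb cb'.
    have E g : g \in B -> c g != 0 -> g = q.2.
      by move=> gB; apply: contraNeq => /(cB _ gB)->.
    by rewrite (E b bB cb) (E b' b'B cb').
move=> x; have [/existsP[a /andP[ca xa]]|] := boolP [exists a : A, (0 < c (val
  a)) && pole x (val a)].
  by rewrite (signomial_pole B (valP a) ca xa).
rewrite negb_exists => /forallP nopole.
have {}nopole a : a \in A -> 0 < c a -> ~~ pole x a.
  by move=> aA ca; have := nopole [` aA]%fset; rewrite /= ca.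
(* If the coefficient at [q.2] vanishes, or is nonnegative with [q.2] in [A], all summands are
   nonnegative. Otherwise [xb] is positive and the circuit inequality applies. *)
have [cq2|hneg] := boolP ((c q.2 == 0) || (q.2 \in A) && (0 <= c q.2)).
  have cA0 a : a \in A -> 0 <= c a.
    by move=> aA; have [->|/(cA _ aA)//] := eqVneq a q.2;
      move: cq2 => /orP[/eqP->|/andP[]].
  rewrite signomial_finite; last first.
    by move=> a aA ca; apply: nopole => //; rewrite lt0r ca cA0.
  rewrite lee_fin addr_ge0 // big_seq; last rewrite big1 // => b bB.
    by apply: sumr_ge0 => a aA; rewrite mulr_ge0 ?cA0 ?abs_monomial_real_ge0.
  have [bq|/(cB _ bB)->] := eqVneq b q.2; last by rewrite mul0r.
  move: cq2; rewrite -bq => /orP[/eqP->|/andP[/notB/(_ bB)//]].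
  by rewrite mul0r.
move: hneg; rewrite negb_or negb_and => /andP[cq2 hneg].
have odd_le : q.2 \in B -> `|c q.2| <= xb.
  move=> q2; apply/hodd/reduced_circuitsP.
  by case: rq => *; split=> //; rewrite in_fsetD qq.
have xb0 : 0 < xb.
  move: qAB; rewrite in_fsetU => /orP[q2|/odd_le]; last first.
    by apply: lt_le_trans; rewrite normr_gt0.
  move: hneg; rewrite q2 /= -ltNge => cq.
  by rewrite (lt_le_trans (y := - c q.2)) ?oppr_gt0 // -subr_ge0 opprK.
have hL := cxb xb0.
(* The geometric mean is at least [Lambda q * xb > 0], so no vertex coefficient vanishes; hence no
   vertex has a pole at [x]. *)
have {}c0 a : a \in q.1 -> 0 < c a.
  move=> aq; rewrite lt0r c0 // andbT; apply/eqP => ca0.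
  have := lt_le_trans (mulr_gt0 (Lambda_gt0 rq) xb0) hL.
  by rewrite (bigD1_seq a) ?fset_uniq //= ca0 powR0 ?gt_eqF ?bary0 // mul0r
    ltxx.
have [_ b1 bq] := hb.
have [pq zq] := abs_monomial_real_bary bary0 bq (fun a aq => nopole a (qA a aq)
  (c0 a aq)).
(* AM-GM for the numbers [c_a |x|^a / lambda_a] with weights [lambda_a]: the denominators multiply
   to [Lambda q], the monomials to the one at [q.2]. *)
have AMGM : xb * abs_monomial_real x q.2 <= \sum_(a <- q.1) c a *
  abs_monomial_real x a.
  have u0 a : a \in q.1 -> 0 <= c a * abs_monomial_real x a / bary q a.
    by move=> aq; rewrite divr_ge0 ?(ltW (bary0 _ _)) // mulr_ge0 ?(ltW (c0 _
      _)) // abs_monomial_real_ge0.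
  have := weighted_AM_GM bary0 b1 u0.
  rewrite [leRHS](eq_big_seq (fun a => c a * abs_monomial_real x a));
    last first.
    by move=> a aq; rewrite mulrC divfK // gt_eqF // bary0.
  apply: le_trans; rewrite -(ler_pM2l (Lambda_gt0 rq)) mulrA -zq.
  apply: le_trans (ler_wpM2r _ hL) _; first by apply: prodr_ge0 => a _;
    exact: powR_ge0.
  rewrite -!big_split big_seq [leRHS]big_seq le_eqVlt; apply/orP; left;
    apply/eqP.
  apply: eq_bigr => a aq /=; have ca := ltW (c0 _ aq);
    have ba := ltW (bary0 _ aq).
  rewrite -powRM ?abs_monomial_real_ge0 // -powRM ?u0 //.
  by congr (_ `^ _); rewrite [RHS]mulrC divfK // gt_eqF // bary0.
rewrite signomial_finite; last first.
  move=> a aA ca; have [->//|aq] := eqVneq a q.2.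
  by apply: nopole => //; rewrite lt0r ca cA.
rewrite lee_fin.
have sumA : q.2 \notin A -> \sum_(a <- A) c a * abs_monomial_real x a =
    \sum_(a <- q.1) c a * abs_monomial_real x a.
  move=> q2; apply/esym/big_fset_incl; first exact/fsubsetP.
  move=> a aA aq; rewrite sc ?mul0r // in_fset1U negb_or aq andbT.
  by apply: contraNneq q2 => <-.
have sumA' : q.2 \in A -> \sum_(a <- A) c a * abs_monomial_real x a =
    c q.2 * abs_monomial_real x q.2 + \sum_(a <- q.1) c a * abs_monomial_real x
      a.
  move=> q2; rewrite -(big_fsetU1 _ (fun a => c a * abs_monomial_real x a)) //.
  apply/esym/big_fset_incl.
    by apply/fsubsetP => a; rewrite in_fset1U => /orP[/eqP->//|/qA].
  by move=> a aA /sc->; rewrite mul0r.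
have z0 := abs_monomial_real_ge0 x q.2.
move: qAB; rewrite in_fsetU => /orP[q2|q2].
  have -> : \sum_(b <- B) c b * monomial x b = 0.
    rewrite big_seq big1 // => b bB; rewrite cB ?mul0r //.
    by apply/eqP => b2; move: bB; rewrite b2 => /(notB _ q2).
  rewrite addr0.
  rewrite sumA' // -lerBlDl sub0r; apply: le_trans AMGM.
  by rewrite -mulNr ler_wpM2r // lerNl -subr_ge0 opprK addrC.
rewrite sumA; last by apply/negP => /notB; apply.
have -> : \sum_(b <- B) c b * monomial x b = c q.2 * monomial x q.2.
  rewrite (bigD1_seq q.2) ?fset_uniq //= big_seq_cond big1 ?addr0 //.
  by move=> b /andP[bB bq']; rewrite cB ?mul0r.
rewrite -lerBlDr sub0r; apply: le_trans AMGM.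
apply: le_trans (ler_norm _) _; rewrite normrN normrM normr_monomial;
  last exact: Bn.
by rewrite ler_wpM2r ?odd_le.
Qed.

End CircuitsAreNonnegative.

(** * Decomposition into reduced circuits *)

Section ReducedDecomposition.
Variables (R : realType) (n : nat).
Implicit Types (S : {fset 'rV[R]_n}) (a b g h : 'rV[R]_n).
Implicit Types t u w : 'rV[R]_n -> R.

(** The ratio at [a0] is the largest multiple of [w] that can be subtracted from [u] without leaving
    the nonnegative orthant; the entry at [a0] then becomes 0. *)
Lemma min_ratio S u w : (exists2 a, a \in S & 0 < w a) ->
  (forall a, a \in S -> 0 <= u a) ->
  exists a0, [/\ a0 \in S, 0 < w a0 &
    forall a, a \in S -> u a0 / w a0 * w a <= u a].
Proof.
move=> [a1 a1S wa1] u0.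
have [a0 wa0 amin] : exists2 a0 : S, 0 < w (val a0) & forall a : S,
    0 < w (val a) -> u (val a0) / w (val a0) <= u (val a) / w (val a).
  case: (@Order.TotalTheory.arg_minP _ _ S [` a1S]%fset (fun a : S => 0 < w
    (val a))
    (fun a : S => u (val a) / w (val a)) wa1) => a0 wa0 amin; by exists a0.
exists (val a0); split=> // [|a aS]; first exact: valP.
have [wa|wa] := ltP 0 (w a).
  by rewrite -ler_pdivlMr // (amin [` aS]%fset).
apply: (le_trans _ (u0 _ aS)); rewrite mulr_ge0_le0 // divr_ge0 ?u0 ?ltW //.
exact: valP.
Qed.

Lemma affinely_independent_sub S S' : {subset S' <= S} ->
  affinely_independent S -> affinely_independent S'.
Proof.
move=> sS iS t t1 tv a aS'; have /fsubsetP sS' := sS.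
have ext (V : nmodType) (F : 'rV[R]_n -> V) :
    (forall a, a \notin S' -> F a = 0) -> \sum_(a <- S) F a = \sum_(a <- S') F
      a.
  by move=> F0; apply/esym/big_fset_incl => // b _; exact: F0.
pose t' b := if b \in S' then t b else 0.
have e b : b \in S' -> t' b = t b by rewrite /t' => ->.
have e0 b : b \notin S' -> t' b = 0 by rewrite /t' => /negbTE->.
rewrite -e //; apply: iS; last exact: sS.
  by rewrite ext // -[RHS]t1; apply: eq_big_seq.
rewrite ext; first by rewrite -[RHS]tv; apply: eq_big_seq => b /e->.
by move=> b /e0->; rewrite scale0r.
Qed.

(** Expanding [g] in its coordinates turns a relation on the new set into one on [S], whose
    coefficient at [a0] is [t g * u a0]; hence [t g = 0]. *)
Lemma affinely_independent_exchange S a0 g u : affinely_independent S ->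
  a0 \in S -> g \notin S -> is_bary (S, g) u -> u a0 != 0 ->
  affinely_independent (g |` (S `\ a0))%fset.
Proof.
move=> iS a0S gS [/= uS u1 ug] u0 t.
have gS0 : g \notin (S `\ a0)%fset by rewrite in_fsetD1 (negbTE gS) andbF.
rewrite !big_fsetU1 //= => t1 tv.
pose t' a := (if a == a0 then 0 else t a) + t g * u a.
have sumD (V : nmodType) (F : 'rV[R]_n -> V) :
    \sum_(a <- S) (if a == a0 then 0 else F a) = \sum_(a <- (S `\ a0)%fset) F a.
  rewrite (big_fsetD1 a0) //= eqxx add0r; apply: eq_big_seq => a.
  by rewrite in_fsetD1 => /andP[/negbTE->].
have t'0 : forall a, a \in S -> t' a = 0.
  apply: iS; first by rewrite big_split /= sumD -mulr_sumr u1 mulr1 addrC.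
  under eq_bigr do rewrite scalerDl (fun_if (fun k => k *: _)) scale0r -scalerA.
  by rewrite big_split /= sumD -scaler_sumr ug addrC.
have tg : t g = 0.
  have := t'0 _ a0S; rewrite /t' eqxx add0r => /eqP.
  by rewrite mulf_eq0 (negbTE u0) orbF => /eqP.
move=> a; rewrite in_fset1U => /orP[/eqP->//|];
  rewrite in_fsetD1 => /andP[aa0 aS].
by have := t'0 _ aS; rewrite /t' (negbTE aa0) tg mul0r addr0.
Qed.

Variables (A B : {fset 'rV[R]_n}).
Let AB := (A `|` B)%fset.

(** Membership in the cone generated by the vectors [bary q - delta_q.2] of the reduced circuits. *)
Definition circuit_relation (v : 'rV[R]_n -> R) : Prop :=
  exists s : circuit R n -> R, (forall q, 0 <= s q) /\
    forall g, v g = \sum_(q <- reduced_circuits A AB) s q * (bary q g - (g ==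
      q.2)%:R).

Lemma circuit_relationD v w : circuit_relation v -> circuit_relation w ->
  circuit_relation (fun g => v g + w g).
Proof.
move=> [s [s0 vs]] [r [r0 wr]]; exists (fun q => s q + r q); split=> [q|g].
  by rewrite addr_ge0.
by rewrite vs wr -big_split; apply: eq_bigr => q _; rewrite mulrDl.
Qed.

Lemma circuit_relationZ k v : 0 <= k -> circuit_relation v ->
  circuit_relation (fun g => k * v g).
Proof.
move=> k0 [s [s0 vs]]; exists (fun q => k * s q); split=> [q|g].
  by rewrite mulr_ge0.
by rewrite vs mulr_sumr; apply: eq_bigr => q _; rewrite mulrA.
Qed.

(** A circuit with vertices in [A] that need not be reduced: its hull may contain further points of
    [A]. *)
Definition circuit_over S b t : Prop :=
  [/\ {subset S <= A}, affinely_independent S, is_bary (S, b) t,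
      forall a, a \in S -> 0 < t a & b \notin S].

Lemma circuit_relation_reduced S b t : circuit_over S b t -> b \in AB ->
  (forall g, g \in A -> convex_hull [set` S] g -> g \in (b |` S)%fset) ->
  circuit_relation (fun g => t g - (g == b)%:R).
Proof.
move=> [SA iS ht t0 bS] bAB hred.
have rq : (S, b) \in reduced_circuits A AB.
  apply/reduced_circuitsP; split=> //=; first exact/fsubsetP.
    exact: relint_hull ht t0.
  by rewrite in_fsetD bS.
exists (fun q => (q == (S, b))%:R); split=> // g.
rewrite (bigD1_seq (S, b)) ?fset_uniq //= eqxx mul1r big1 ?addr0.
  by rewrite (is_bary_bary (q := (S, b)) iS ht).
by move=> q /negbTE->; rewrite mul0r.
Qed.

Definition hull_card S : nat :=
  #|` [fset a in A | `[< convex_hull [set` S] a >]]%fset|.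

(** The coordinate at [a0] is an affine function bounded by [k < 1] on [S'], hence on its hull,
    which lies in the hull of [S] and therefore misses [a0]. *)
Lemma hull_card_lt S S' a0 (k : R) : affinely_independent S -> {subset S <= A}
  ->
  a0 \in S -> k < 1 ->
  (forall a, a \in S' -> exists t, [/\ is_bary (S, a) t, forall b, 0 <= t b &
     t a0 <= k]) ->
  (hull_card S' < hull_card S)%N.
Proof.
move=> iS SA a0S k1 hS'; apply: fproper_ltn_card; rewrite /fproper;
  apply/andP; split; [apply/fsubsetP|apply/fsubsetPn].
- move=> h; rewrite !inE /= => /andP[-> /asboolP/convex_hullP[u [uS' u0 u1
  <-]]].
  apply/asboolP/convex_hullP.
  have /choice[T hT] : forall a, exists t, a \in S' ->
      is_bary (S, a) t /\ forall b, 0 <= t b.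
    by move=> a; have [/hS'[t [ht t0 _]]|_] := boolP (a \in S');
      [exists t|exists (fun=> 0)].
  exists (fun b => \sum_(a <- S') u a * T a b); split.
  + move=> b bS; rewrite big_seq big1 // => a aS'.
    by have [[/= Ta _ _] _] := hT a aS'; rewrite Ta ?mulr0.
  + move=> b; rewrite big_seq; apply: sumr_ge0 => a aS'.
    by rewrite mulr_ge0 // (hT a aS').2.
  + rewrite exchange_big /= -u1; apply: eq_big_seq => a aS'.
    by have [[/= _ Ta _] _] := hT a aS'; rewrite -mulr_sumr Ta mulr1.
  + under eq_bigr do rewrite scaler_suml.
    rewrite exchange_big /=; apply: eq_big_seq => a aS'.
    have [[/= _ _ Ta] _] := hT a aS'; rewrite -[X in _ = _ *: X]Ta scaler_sumr.
    by apply: eq_bigr => b _; rewrite scalerA.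
- exists a0; first by rewrite !inE /= SA //=; apply/asboolP/convex_hull_mem.
  rewrite !inE SA //=; apply/asboolP => /convex_hullP[u [uS' u0 u1 ua0]].
  have [y [r yr]] := affine_interpolation (fun b => (b == a0)%:R) iS.
  have E t : \sum_(b <- S) t b = 1 -> dot y (\sum_(b <- S) t b *: b) + r = t a0.
    move=> t1; rewrite dot_sumr -[r]mul1r -t1 mulr_suml -big_split/=.
    rewrite (bigD1_seq a0) ?fset_uniq //= dotZr -mulrDr yr // eqxx mulr1.
    rewrite big_seq_cond big1 ?addr0 // => b /andP[bS bneq].
    by rewrite dotZr -mulrDr yr // (negbTE bneq) mulr0.
  have : dot y a0 + r <= k.
    rewrite -ua0 dot_sumr -[r]mul1r -u1 mulr_suml -big_split /=.
    rewrite -[leRHS]mul1r -u1 mulr_suml big_seq [leRHS]big_seq;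
      apply: ler_sum => a aS'.
    rewrite dotZr -mulrDr ler_wpM2l //.
    by have [t [[/= _ t1 ta] _ tk]] := hS' a aS'; rewrite -ta E.
  by rewrite yr // eqxx leNgt k1.
Qed.

(** The largest multiple [s] of [u - delta_g] is subtracted from [t]: a vertex [a0] attaining the
    minimal ratio disappears and [g] enters with weight [s]. If [s] were 1, then [t = u] and
    [b = g]. *)
Lemma circuit_exchange S b t g u : circuit_over S b t -> g \in A ->
  g \notin S -> g != b -> is_bary (S, g) u -> (forall a, 0 <= u a) ->
  exists s S' r, [/\ 0 < s < 1, circuit_over S' b r,
    (hull_card S' < hull_card S)%N &
    forall h, t h = s * (u h - (h == g)%:R) + r h].
Proof.
move=> [SA iS ht t0 bS] gA gS gb hu u0; have [/= tS t1 tb] := ht;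
  have [/= uS u1 ug] := hu.
have ex : exists2 a, a \in S & 0 < u a.
  apply: contrapT => h; move: u1; rewrite big_seq big1 => [/eqP|a aS].
    by rewrite eq_sym oner_eq0.
  by apply/eqP; move: (u0 a); rewrite le_eqVlt eq_sym => /orP[//|ua]; case: h;
    exists a.
have [a0 [a0S ua0 hmin]] := min_ratio ex (fun a aS => ltW (t0 a aS)).
pose s := t a0 / u a0; pose r h := t h - s * (u h - (h == g)%:R).
have s0 : 0 < s by rewrite divr_gt0 // t0.
have us a : a \in S -> s * u a <= t a by exact: hmin.
have sumeq a : s = 1 -> t a = u a.
  move=> s1; have [aS|aS] := boolP (a \in S); last by rewrite tS ?uS.
  have sum0 : \sum_(a <- S) (t a - u a) = 0 by rewrite sumrB t1 u1 subrr.
  apply/eqP; rewrite -subr_eq0; apply/eqP.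
  have ge h : h \in S -> 0 <= t h - u h.
    by move=> /us; rewrite s1 mul1r subr_ge0.
  move: sum0 => /eqP; rewrite big_seq psumr_eq0 // => /allP/(_ a aS).
  by rewrite aS => /eqP.
have s1 : s < 1.
  rewrite lt_neqAle; apply/andP; split.
    apply: contra gb => /eqP s1; rewrite -ug -tb; apply/eqP.
    by apply: eq_bigr => a _; rewrite sumeq.
  have : s * \sum_(a <- S) u a <= \sum_(a <- S) t a.
    by rewrite mulr_sumr big_seq [leRHS]big_seq; exact: ler_sum.
  by rewrite u1 t1 mulr1.
have ra0 : r a0 = 0.
  rewrite /r (negbTE (memPn gS _ a0S)) subr0 /s divfK ?subrr // gt_eqF //.
have rg : r g = s by rewrite /r eqxx tS // uS // sub0r sub0r mulrN1 opprK.
have r0 a : 0 <= r a.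
  have [->|ag] := eqVneq a g; first by rewrite rg ltW.
  have [aS|aS] := boolP (a \in S); rewrite /r (negbTE ag) subr0.
    by rewrite subr_ge0 us.
  by rewrite tS // uS // mulr0 subr0.
pose S1 := (g |` (S `\ a0))%fset.
have rS1 a : a \notin S1 -> r a = 0.
  rewrite in_fset1U in_fsetD1 negb_or negb_and negbK => /andP[ag
    /orP[/eqP->//|aS]].
  by rewrite /r (negbTE ag) tS // uS // subr0 mulr0 subr0.
(* Ties in the minimal ratio make further weights vanish, so only the positive ones are kept. *)
pose S' := [fset a in S1 | 0 < r a]%fset.
have memS' a : (a \in S') = (a \in S1) && (0 < r a) by rewrite !inE.
have S'S1 : {subset S' <= S1} by move=> a; rewrite memS' => /andP[].
have sumS' (V : lmodType R) (F : 'rV[R]_n -> V) :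
    \sum_(a <- S') r a *: F a = \sum_(a <- S) t a *: F a - s *: (\sum_(a <- S)
      u a *: F a - F g).
  rewrite (big_fset_incl _ (B := S1)); last 2 first.
  - exact/fsubsetP.
  - move=> a aS1; rewrite memS' aS1 /= -leNgt => ra.
    by have /eqP-> : r a == 0; [rewrite eq_le ra r0|rewrite scale0r].
  have gS0 : g \notin (S `\ a0)%fset by rewrite in_fsetD1 (negbTE gS) andbF.
  rewrite big_fsetU1 //= rg.
  have -> : \sum_(a <- (S `\ a0)%fset) r a *: F a = \sum_(a <- S) r a *: F a.
    by rewrite [RHS](big_fsetD1 a0) //= ra0 scale0r add0r.
  have -> : \sum_(a <- S) r a *: F a = \sum_(a <- S) (t a *: F a - s *: (u a *:
    F a)).
    apply: eq_big_seq => a aS; rewrite /r (negbTE (memPn gS _ aS)) subr0.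
    by rewrite scalerBl scalerA.
  by rewrite sumrB -scaler_sumr scalerBr opprB addrCA addrA addrAC.
exists s, S', r; split; first by rewrite s0.
- split.
  + move=> a /S'S1; rewrite in_fset1U in_fsetD1 => /orP[/eqP->//|/andP[_]];
    exact: SA.
  + apply: affinely_independent_sub S'S1 _.
    by apply: affinely_independent_exchange iS a0S gS hu _; rewrite gt_eqF.
  + split => /=.
    * move=> a; rewrite memS' negb_and => /orP[/rS1//|].
      by rewrite -leNgt => ra; apply/le_anti; rewrite ra r0.
    * have := sumS' R^o (fun=> 1).
      have e (T : {fset 'rV[R]_n}) f : \sum_(a <- T) f a *: (1 : R^o) = \sum_(a
        <- T) f a.
        by apply: eq_bigr => a _; rewrite -[LHS]/(f a * 1) mulr1.
      by rewrite !e t1 u1 subrr scaler0 subr0.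
    * by have := sumS' _ id; rewrite /= ug tb subrr scaler0 subr0.
  + by move=> a; rewrite memS' => /andP[].
  + apply/negP => /S'S1; rewrite in_fset1U in_fsetD1 eq_sym (negbTE gb) /=.
    by rewrite (negbTE bS) andbF.
(* The new vertex [g] has coordinate [u a0] at [a0], which is below 1 since otherwise [g] would be
   [a0]; the surviving old vertices have coordinate 0. *)
- apply: (@hull_card_lt _ _ a0 (u a0)) => //.
    have ua1 : u a0 + \sum_(a <- (S `\ a0)%fset) u a = 1 by rewrite -u1
      [RHS](big_fsetD1 a0).
    have u0' : 0 <= \sum_(a <- (S `\ a0)%fset) u a by exact: sumr_ge0.
    rewrite lt_neqAle -{2}ua1 lerDl u0' andbT; apply/eqP => ua01.
    have : \sum_(a <- (S `\ a0)%fset) u a = 0 by apply/eqP;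
      rewrite -(inj_eq (addrI 1)) -{1}ua01 ua1 addr0.
    move/eqP; rewrite psumr_eq0 // => /allP h.
    move: gS; rewrite -ug (big_fsetD1 a0) //= ua01 scale1r big_seq big1 ?addr0
      ?a0S //.
    by move=> a /h/eqP->; rewrite scale0r.
  move=> a /S'S1; rewrite in_fset1U in_fsetD1 => /orP[/eqP->|/andP[aa0 aS]].
    by exists u; split.
  exists (fun b => (b == a)%:R); split=> //;
    last by rewrite eq_sym (negbTE aa0) ltW.
  split => /=.
  + by move=> c cS; case: eqP => // ca; rewrite ca aS in cS.
  + by rewrite (bigD1_seq a) ?fset_uniq //= eqxx big1 ?addr0 // => c /negbTE->.
  + rewrite (bigD1_seq a) ?fset_uniq //= eqxx scale1r big1 ?addr0 // => c
    /negbTE->.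
    by rewrite scale0r.
- by move=> h; rewrite /r addrC subrK.
Qed.

End ReducedDecomposition.

(** * Caratheodory's theorem and relations of arbitrary simplices *)

Section Simplices.
Variables (R : realType) (n : nat).
Implicit Types (S : {fset 'rV[R]_n}) (a b g h : 'rV[R]_n).
Implicit Types t u w : 'rV[R]_n -> R.

(** Induction on the number of points: a point of weight 0 is dropped, and an affine dependency
    allows shifting the weights until one of them vanishes. *)
Lemma Caratheodory S b u : (forall a, a \in S -> 0 <= u a) ->
  \sum_(a <- S) u a = 1 -> \sum_(a <- S) u a *: a = b ->
  exists S' t, [/\ {subset S' <= S}, affinely_independent S', is_bary (S', b) t
    &
    forall a, a \in S' -> 0 < t a].
Proof.
have [N] := ubnP #|` S|; elim: N S u => // N IH S u SN u0 u1 ub.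
have drop a (v : 'rV[R]_n -> R) : a \in S -> v a = 0 ->
    (forall a, a \in S -> 0 <= v a) -> \sum_(a <- S) v a = 1 ->
    \sum_(a <- S) v a *: a = b -> exists S' t, [/\ {subset S' <= S},
      affinely_independent S', is_bary (S', b) t & forall a, a \in S' -> 0 < t
        a].
  move=> aS va v0 v1 vb; have [|h|||S' [t [S'S iS' hb t0]]] := IH (S `\ a)%fset
    v.
  - by move: SN; rewrite (cardfsD1 a) aS.
  - by rewrite in_fsetD1 => /andP[_ /v0].
  - by rewrite -v1 [RHS](big_fsetD1 a) //= va add0r.
  - by rewrite -vb [RHS](big_fsetD1 a) //= va scale0r add0r.
  by exists S', t; split=> // h /S'S; rewrite in_fsetD1 => /andP[].
have [[a aS ua]|noz] := pselect (exists2 a, a \in S & u a = 0).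
  exact: (drop a u).
have {}u0 a : a \in S -> 0 < u a.
  move=> aS; rewrite lt0r u0 // andbT; apply/eqP => ua; by apply: noz; exists a.
have [iS|niS] := pselect (affinely_independent S).
  exists S, (fun a => if a \in S then u a else 0); split=> //;
    last by move=> a aS; rewrite aS u0.
  split=> /=.
  - by move=> a /negbTE->.
  - by rewrite -[RHS]u1; apply: eq_big_seq => a ->.
  - by rewrite -[RHS]ub; apply: eq_big_seq => a ->.
have [w [w1 wb [a aS wa]]] : exists w, [/\ \sum_(a <- S) w a = 0,
    \sum_(a <- S) w a *: a = 0 & exists2 a, a \in S & w a != 0].
  apply: contrapT => h; apply: niS => w w1 wb a aS; apply/eqP; apply: contrapT.
  by move=> /negP wa; apply: h; exists w; split=> //; exists a.
have ex : exists2 a, a \in S & 0 < w a.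
  apply: contrapT => h; have wle c : c \in S -> 0 <= - w c.
    by move=> cS; rewrite oppr_ge0 leNgt; apply/negP => wc; apply: h; exists c.
  move: w1 => /eqP; rewrite -oppr_eq0 -sumrN big_seq psumr_eq0 // => /allP/(_ a
    aS).
  by rewrite aS oppr_eq0 (negbTE wa).
have [a0 [a0S wa0 hmin]] := min_ratio ex (fun a aS => ltW (u0 a aS)).
apply: (drop a0 (fun a => u a - u a0 / w a0 * w a)) => //.
- by rewrite divfK ?subrr // gt_eqF.
- by move=> c cS; rewrite subr_ge0 hmin.
- by rewrite sumrB -mulr_sumr w1 mulr0 subr0.
- under eq_bigr do rewrite scalerBl -scalerA.
  by rewrite sumrB -scaler_sumr wb scaler0 subr0.
Qed.

Variables (A B : {fset 'rV[R]_n}).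
Let AB := (A `|` B)%fset.

(** Passes to the face of the simplex that contains [g] in its relative interior. *)
Lemma circuit_over_support S g u : {subset S <= A} -> affinely_independent S ->
  g \notin S -> is_bary (S, g) u -> (forall a, 0 <= u a) ->
  circuit_over A [fset a in S | 0 < u a]%fset g u.
Proof.
move=> SA iS gS [/= uS u1 ug] u0; set S' := [fset a in S | 0 < u a]%fset.
have memS' a : (a \in S') = (a \in S) && (0 < u a) by rewrite !inE.
have S'S : {subset S' <= S} by move=> a; rewrite memS' => /andP[].
have uS' a : a \notin S' -> u a = 0.
  rewrite memS' negb_and => /orP[/uS//|].
  by rewrite -leNgt => ua; apply/le_anti; rewrite ua u0.
split.
- by move=> a /S'S/SA.
- exact: affinely_independent_sub S'S iS.
- split=> //=.
    rewrite -[RHS]u1; apply: big_fset_incl; first exact/fsubsetP.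
    by move=> a _ /uS'.
  rewrite -[RHS]ug; apply: big_fset_incl; first exact/fsubsetP.
  by move=> a _ /uS'->; rewrite scale0r.
- by move=> a; rewrite memS' => /andP[].
- by apply: contra gS => /S'S.
Qed.

Lemma circuit_relation_even S b t : circuit_over A S b t -> b \in A ->
  circuit_relation A B (fun g => t g - (g == b)%:R).
Proof.
have [N] := ubnP (hull_card A S); elim: N S b t => // N IH S b t SN hS bA.
have [hred|] := pselect (forall g, g \in A -> convex_hull [set` S] g ->
    g \in (b |` S)%fset).
  by apply: circuit_relation_reduced hS _ hred; rewrite in_fsetU bA.
move=> /existsNP[g /not_implyP[gA /not_implyP[gS /negP]]].
rewrite in_fset1U negb_or => /andP[gb gnS].
have /convex_hullP[u [uS u0 u1 ug]] := gS.
have hu : is_bary (S, g) u by [].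
have [s [S' [r [/andP[s0 s1] hr S'S e]]]] := circuit_exchange hS gA gnS gb hu
  u0.
have Kr := IH _ _ _ (leq_trans S'S SN) hr bA.
have [SA iS ht t0 bS] := hS.
(* If [u] vanishes at a vertex [a1], then [g] lies on a face missing [a1], whose hull contains fewer
   points of [A]. *)
have [[a1 a1S ua1]|full] := pselect (exists2 a, a \in S & u a = 0).
  have hu' := circuit_over_support SA iS gnS hu u0.
  have /IH/(_ hu' gA) Ku : (hull_card A [fset a in S | (0 < u a)%R]%fset < N)%N.
    apply: (@leq_trans (hull_card A S)); last exact: SN.
    apply: (@hull_card_lt _ _ _ _ _ a1 0) => // a.
    rewrite !inE /= => /andP[aS ua]; exists (fun c => (c == a)%:R); split=> //.
      split=> /=.
      - by move=> c cS; case: eqP => // ca; rewrite ca aS in cS.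
      - by rewrite (bigD1_seq a) ?fset_uniq //= eqxx big1 ?addr0 // => c
        /negbTE->.
      - rewrite (bigD1_seq a) ?fset_uniq //= eqxx scale1r big1 ?addr0 // => c
        /negbTE->.
        by rewrite scale0r.
    by case: eqP => // a1a; rewrite -a1a ua1 ltxx in ua.
  have := circuit_relationD (circuit_relationZ (ltW s0) Ku) Kr.
  by under eq_fun do rewrite addrA -e.
(* Here [u - delta_g] has the same hull as [t - delta_b], so induction does not
   apply to it; exchanging back gives [u - delta_g = s' (t - delta_b) + r'] and
   [1 - s s'] can be divided out. *)
have hSg : circuit_over A S g u.
  split=> // a aS; rewrite lt0r u0 andbT; apply/eqP => ua; by apply: full;
    exists a.
have t0' a : 0 <= t a.
  have [/t0/ltW//|] := boolP (a \in S); by have [/= tS _ _] := ht; move=> /tS->.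
rewrite eq_sym in gb.
have [s' [S'' [r' [/andP[s'0 s'1] hr' S''S e']]]] := circuit_exchange hSg bA bS
  gb ht t0'.
have Kr' := IH _ _ _ (leq_trans S''S SN) hr' gA.
have ss1 : 0 < 1 - s * s'.
  by rewrite subr_gt0 (le_lt_trans (y := s)) // ler_piMr ?ltW.
have := circuit_relationD (circuit_relationZ (ltW s0) Kr') Kr.
have ss0 : 0 <= (1 - s * s')^-1 by rewrite invr_ge0 ltW.
move=> /(circuit_relationZ ss0); congr circuit_relation.
apply/funext => h; have eh := e h; have eh' := e' h.
apply: (mulfI (lt0r_neq0 ss1)); rewrite mulVKf ?lt0r_neq0 //.
have -> : r' h = u h - s' * (t h - (h == b)%:R) by rewrite eh'; ring.
have -> : r h = t h - s * (u h - (h == g)%:R) by rewrite eh; ring.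
ring.
Qed.

Lemma circuit_relation_simplex S b t : circuit_over A S b t -> b \in AB ->
  circuit_relation A B (fun g => t g - (g == b)%:R).
Proof.
have [N] := ubnP (hull_card A S); elim: N S t => // N IH S t SN hS bA.
have [hred|] := pselect (forall g, g \in A -> convex_hull [set` S] g ->
    g \in (b |` S)%fset).
  exact: circuit_relation_reduced hS _ hred.
move=> /existsNP[g /not_implyP[gA /not_implyP[gS /negP]]].
rewrite in_fset1U negb_or => /andP[gb gnS].
have /convex_hullP[u [uS u0 u1 ug]] := gS.
have hu : is_bary (S, g) u by [].
have [s [S' [r [/andP[s0 s1] hr S'S e]]]] := circuit_exchange hS gA gnS gb hu
  u0.
have Kr := IH _ _ (leq_trans S'S SN) hr bA.
have [SA iS _ _ _] := hS.
have Ku := circuit_relation_even (circuit_over_support SA iS gnS hu u0) gA.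
have := circuit_relationD (circuit_relationZ (ltW s0) Ku) Kr.
by under eq_fun do rewrite addrA -e.
Qed.

End Simplices.

(** * Sums of circuit vectors *)

Section SocCone.
Variables (R : realType) (n : nat) (A B : {fset 'rV[R]_n}).
Let AB := (A `|` B)%fset.
Let RC := reduced_circuits A AB.
Variable (arr : circuit R n -> seq (option 'rV[R]_n)).
Hypotheses (Aq : forall a, a \in A -> rational_exponent a)
  (ABq : forall a, a \in AB -> rational_exponent a)
  (AB0 : (A `&` B)%fset = fset0)
  (arrP : forall q, q \in RC -> perm_eq (arr q) (labels q)).
Implicit Types (c t u w : 'rV[R]_n -> R) (q : circuit R n).

Definition soc_cone c : Prop := exists cc : circuit R n -> 'rV[R]_n -> R,
  [/\ forall q, q \in RC -> circuit_cone A B q (arr q) (cc q),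
      forall g, g \notin uncovered A B -> c g = \sum_(q <- RC) cc q g &
      forall a, a \in uncovered A B -> 0 <= c a].

Lemma eq_soc_cone c c' : (forall g, c g = c' g) -> soc_cone c -> soc_cone c'.
Proof. by move=> /funext->. Qed.

Lemma soc_coneD c c' : soc_cone c -> soc_cone c' -> soc_cone (fun g => c g + c'
  g).
Proof.
move=> [cc [h1 h2 h3]] [cc' [h1' h2' h3']].
exists (fun q g => cc q g + cc' q g); split.
- by move=> q qRC; apply: circuit_coneD; [exact: h1|exact: h1'].
- by move=> g gU; rewrite h2 // h2' // -big_split.
- by move=> a aU; rewrite addr_ge0 ?h3 ?h3'.
Qed.

Lemma soc_coneZ r c : 0 <= r -> soc_cone c -> soc_cone (fun g => r * c g).
Proof.
move=> r0 [cc [h1 h2 h3]]; exists (fun q g => r * cc q g); split.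
- by move=> q qRC; apply: circuit_coneZ => //; exact: h1.
- by move=> g gU; rewrite h2 // mulr_sumr.
- by move=> a aU; rewrite mulr_ge0 ?h3.
Qed.

Lemma soc_cone0 : soc_cone (fun=> 0).
Proof.
exists (fun _ _ => 0); split=> //; last by move=> g _; rewrite big1.
by move=> q _; exact: circuit_cone0.
Qed.

Lemma soc_cone_sum (I : Type) (r : seq I) (P : pred I) (F : I -> 'rV[R]_n -> R)
  :
  (forall i, P i -> soc_cone (F i)) ->
  soc_cone (fun g => \sum_(i <- r | P i) F i g).
Proof.
move=> hF; elim: r => [|i r IH].
  by apply: eq_soc_cone soc_cone0 => g; rewrite big_nil.
case Pi : (P i); last by apply: eq_soc_cone IH => g; rewrite big_cons Pi.
by apply: eq_soc_cone (soc_coneD (hF i Pi) IH) => g; rewrite big_cons Pi.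
Qed.

Lemma uncoveredP a : a \in uncovered A B <-> a \in A /\
  forall q, q \in RC -> a \notin (q.2 |` q.1)%fset.
Proof.
rewrite /uncovered !inE /=; split=> [/andP[-> /allP h]|[-> h]]; first by split.
by apply/allP.
Qed.

Lemma soc_cone_circuit q c : q \in RC -> circuit_cone A B q (arr q) c ->
  soc_cone c.
Proof.
move=> qRC hc; have [sc _] := hc.
exists (fun q' => if q' == q then c else fun=> 0); split.
- by move=> q' _; case: eqP => [->//|_]; exact: circuit_cone0.
- move=> g _; rewrite (bigD1_seq q) ?fset_uniq //= eqxx big1 ?addr0 //.
  by move=> q' /negbTE->.
- by move=> a /uncoveredP[_ /(_ _ qRC)/sc->].
Qed.

(** An uncovered exponent may carry any nonnegative coefficient; a covered one is absorbed into some
    circuit containing it. *)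
Lemma soc_cone_monomial a r : a \in A -> 0 <= r ->
  soc_cone (fun g => r * (g == a)%:R).
Proof.
move=> aA r0; have [aU|aU] := boolP (a \in uncovered A B).
  exists (fun _ _ => 0); split.
  - by move=> q _; exact: circuit_cone0.
  - by move=> g gU; rewrite big1 //; case: eqP => [ga|_];
    rewrite ?mulr0 // -ga (negbTE gU) in aU *.
  - by move=> g _; rewrite mulr_ge0.
have [q qRC aq] : exists2 q, q \in RC & a \in (q.2 |` q.1)%fset.
  apply: contrapT => h; move/negP: aU; apply; apply/uncoveredP;
    split=> // q qRC.
  by apply/negP => aq; apply: h; exists q.
apply: (soc_cone_circuit qRC); exact: circuit_cone_monomial.
Qed.

Lemma soc_cone_nonneg c : supported A c -> (forall a, a \in A -> 0 <= c a) ->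
  soc_cone c.
Proof.
move=> sc c0; apply: (@eq_soc_cone (fun g => \sum_(a <- A | a \in A) c a * (g
  == a)%:R)).
  move=> g; rewrite -big_seq; have [gA|gA] := boolP (g \in A).
    rewrite (bigD1_seq g) ?fset_uniq //= eqxx mulr1 big1 ?addr0 //.
    by move=> a ag; rewrite eq_sym (negbTE ag) mulr0.
  rewrite sc // big_seq big1 // => a aA; case: eqP => [ga|]; rewrite ?mulr0 //.
  by rewrite -ga (negbTE gA) in aA.
by apply: soc_cone_sum => a aA; apply: soc_cone_monomial => //; exact: c0.
Qed.

(* The relation [t - delta_b = sum_q s_q (bary q - delta_q.2)] survives
   multiplication by [w = exp (affine function)]: every summand becomes a
   circuit vector on which the circuit inequality is tight. *)
Lemma soc_cone_simplex S b t w k e : circuit_over A S b t -> b \in AB ->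
  (forall a, 0 < w a) -> 0 <= k ->
  `|e| <= k * expR (\sum_(a <- S) t a * ln (w a)) ->
  soc_cone (fun g => k * t g * w g + e * (g == b)%:R).
Proof.
move=> hS bAB w0 k0 he; have [SA iS [/= tS t1 tb] t0 bS] := hS.
have [y [r yr]] := affine_interpolation (fun a => ln (w a)) iS.
(* [E] agrees with [w] on [S]; being the exponential of an affine function, its value at [q.2] is
   the weighted geometric mean of its values at the vertices of [q]. *)
pose E g := expR (dot y g + r).
have E0 g : 0 < E g by exact: expR_gt0.
have Ebary (T : {fset 'rV[R]_n}) v g : is_bary (T, g) v ->
    E g = expR (\sum_(a <- T) v a * (dot y a + r)).
  move=> [/= _ v1 vg]; rewrite /E; congr expR.
  rewrite -vg dot_sumr -[in LHS](mul1r r) -v1 mulr_suml -big_split /=.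
  by apply: eq_bigr => a _; rewrite dotZr mulrDr.
have Eb : E b = expR (\sum_(a <- S) t a * ln (w a)).
  rewrite (Ebary S t) //; congr expR; apply: eq_big_seq => a aS.
  by rewrite yr.
have Ew g : t g * w g = t g * E g.
  have [gS|/tS->] := boolP (g \in S); last by rewrite !mul0r.
  by rewrite /E yr // lnK // posrE.
have [s [s0 hs]] := circuit_relation_simplex hS bAB.
(* An exponent of [B] is never a vertex, so the relation evaluated at [b] sees only the circuits
   centred there. *)
have sb : b \in B -> \sum_(q <- RC) s q * (b == q.2)%:R = 1.
  move=> bB; have := hs b; rewrite tS // eqxx sub0r -[LHS]/(- (1 : R)) => hb1.
  rewrite -[RHS]opprK [X in _ = - X]hb1 -sumrN; apply: eq_big_seq => q qRC.
  have [_ _ qA] := reduced_notin ((reduced_circuitsP _ _ _).1 qRC).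
  have [b0 _ _] := reduced_is_bary ((reduced_circuitsP _ _ _).1 qRC).
  rewrite b0; first by rewrite sub0r mulrN opprK.
  by apply/negP => /qA bA; have := in_fset0 b; rewrite -AB0 in_fsetI bA bB.
(* For [b] in [B] the circuits centred at [b] share [e] in proportion to [s q], of total 1 by [sb];
   all others take the most negative value allowed by the circuit inequality. *)
pose i q := if (b \in B) && (q.2 == b) then s q * e else - (k * s q * E q.2).
pose D q g := k * s q * bary q g * E g + i q * (g == q.2)%:R.
have hD q : q \in RC -> soc_cone (D q).
  move=> qRC; have rq := (reduced_circuitsP _ _ _).1 qRC.
  have [qq _ _] := reduced_notin rq.
  have hq := reduced_is_bary rq; have [b0 b1 bq] := hq.
  have bary0 := reduced_bary_gt0 rq.
  have kE : 0 <= k * s q * E q.2 by rewrite !mulr_ge0 // ltW.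
  have ile : `|i q| <= k * s q * E q.2.
    rewrite /i; case: ifP => [/andP[_ /eqP->]|_];
      last by rewrite normrN ger0_norm.
    by rewrite normrM ger0_norm // [k * _]mulrC -mulrA ler_wpM2l // Eb.
  have D2 : D q q.2 = i q by rewrite /D b0 // mulr0 mul0r add0r eqxx mulr1.
  have D1 a : a \in q.1 -> D q a = k * s q * bary q a * E a.
    by move=> aq; rewrite /D (negbTE (memPn qq _ aq)) mulr0 addr0.
  apply: (soc_cone_circuit qRC).
  apply: (circuit_cone_tight Aq ABq rq (arrP qRC) (xb := k * s q * E q.2)) =>
    //.
  - move=> g; rewrite in_fset1U negb_or => /andP[g2 g1].
    by rewrite /D b0 // (negbTE g2) !mulr0 mul0r addr0.
  - by move=> a aq; rewrite D1 // !mulr_ge0 // ltW // bary0.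
  (* Each factor splits into a power of [k * s q], a factor of [Lambda q] and an exponential. The
     exponent 1 lets [powR_weighted_sum] collect the first kind; the exponentials multiply to
     [E q.2]. *)
  - rewrite (eq_big_seq (fun a => ((k * s q) `^ 1) `^ bary q a *
        (bary q a `^ bary q a * expR (bary q a * (dot y a + r))))); last first.
      move=> a aq; have ba := ltW (bary0 _ aq).
      rewrite D1 // powRr1 ?mulr_ge0 // -mulrA powRM ?mulr_ge0 ?(ltW (E0 a)) //.
      have -> : (bary q a * E a) `^ bary q a =
          bary q a `^ bary q a * expR (bary q a * (dot y a + r)) => //.
      by rewrite powRM ?(ltW (E0 a)) // /E -expRM [(_ + _) * _]mulrC.
    rewrite !big_split /= -expR_sum powR_weighted_sum //.
    have -> : \sum_(a <- q.1) bary q a * 1 = 1.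
      by rewrite -[RHS]b1; apply: eq_bigr => a _; rewrite mulr1.
    by rewrite powRr1 ?mulr_ge0 // -(Ebary q.1 (bary q) q.2 hq) mulrCA.
  - by rewrite D2; have := ile; rewrite ler_norml => /andP[] + _;
    rewrite lerNl -subr_ge0 opprK addrC.
  - by move=> _; rewrite D2.
have hsum : soc_cone (fun g => \sum_(q <- RC | q \in RC) D q g) by exact:
  soc_cone_sum.
have sumD g : \sum_(q <- RC | q \in RC) D q g =
   k * E g * (\sum_(q <- RC) s q * bary q g) + \sum_(q <- RC) i q * (g ==
     q.2)%:R.
  by rewrite -big_seq big_split mulr_sumr; congr (_ + _);
    apply: eq_bigr => q _ /=; ring.
have sumbary g : \sum_(q <- RC) s q * bary q g =
    t g - (g == b)%:R + \sum_(q <- RC) s q * (g == q.2)%:R.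
  by rewrite hs -big_split; apply: eq_bigr => q _ /=; ring.
have [bB|bB] := boolP (b \in B).
  apply: eq_soc_cone hsum => g; rewrite sumD sumbary;
    have [->|gb] := eqVneq g b.
    rewrite sb // tS // mulr0 mul0r !add0r addNr mulr0 add0r mulr1.
    transitivity (\sum_(q <- RC) s q * (b == q.2)%:R * e).
      apply: eq_bigr => q _; rewrite /i bB [b == _]eq_sym.
      by case: eqP => _ /=; rewrite ?mulr0 ?mul0r // !mulr1.
    by rewrite -mulr_suml sb // mul1r.
  have -> : \sum_(q <- RC) i q * (g == q.2)%:R =
      - (k * E g * \sum_(q <- RC) s q * (g == q.2)%:R).
    rewrite mulr_sumr -sumrN; apply: eq_bigr => q _; rewrite /i.
    case: (eqVneq q.2 b) => [->|_]; first by rewrite (negbTE gb) !mulr0 oppr0.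
    rewrite andbF; case: eqP => [->|_]; last by rewrite !mulr0 oppr0.
    by ring.
  by rewrite -[k * _ * w _]mulrA Ew subr0 mulr0 addr0; ring.
have bA : b \in A by move: bAB; rewrite in_fsetU (negbTE bB) orbF.
(* For [b] in [A] the circuits produce the coefficient [- k * E b] at [b]; the difference to [e] is
   nonnegative and is added as a monomial. *)
have kb : 0 <= k * E b + e.
  by move: he; rewrite -Eb ler_norml => /andP[+ _];
    rewrite lerNl -subr_ge0 opprK addrC.
apply: eq_soc_cone (soc_coneD hsum (soc_cone_monomial bA kb)) => g.
rewrite sumD sumbary.
have -> : \sum_(q <- RC) i q * (g == q.2)%:R =
    - (k * E g * \sum_(q <- RC) s q * (g == q.2)%:R).
  rewrite mulr_sumr -sumrN; apply: eq_bigr => q _; rewrite /i (negbTE bB) /=.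
  by case: eqP => [->|_]; [ring|rewrite !mulr0 oppr0].
rewrite -[k * _ * w _]mulrA Ew; case: (eqVneq g b) => [->|_]; first by ring.
by rewrite !mulr0 subr0 !addr0; ring.
Qed.

(* Splits off one simplex at a time.  Every simplex [t] taken with weight [k]
   contributes [k * expR (\sum_a t a * ln (w a))], which is at least
   [k * \sum_a t a * (1 + ln (w a))]; these lower bounds add up. *)
Lemma soc_cone_measure b S u w : b \in AB -> (forall a, 0 < w a) ->
  {subset S <= A} -> b \notin S -> supported S u -> (forall a, a \in S -> 0 < u
    a) ->
  \sum_(a <- S) u a *: a = (\sum_(a <- S) u a) *: b ->
  exists k, [/\ 0 <= k, \sum_(a <- S) u a * (1 + ln (w a)) <= k &
    forall e, `|e| <= k -> soc_cone (fun g => u g * w g + e * (g == b)%:R)].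
Proof.
move=> bAB w0; have [N] := ubnP #|` S|.
elim: N S u => // N IH S u SN SA bS uS u0 ub.
have [S0|[a1 a1S]] := fset_0Vmem S.
  exists 0; split=> // [|e].
    by rewrite S0 big_seq_fset0.
  rewrite normr_le0 => /eqP->; apply: eq_soc_cone soc_cone0 => g.
  by rewrite uS ?S0 // !mul0r addr0.
have T0 : 0 < \sum_(a <- S) u a.
  rewrite (bigD1_seq a1) ?fset_uniq //= ltr_pwDl ?u0 // big_seq_cond sumr_ge0
    //.
  by move=> a /andP[/u0/ltW].
set T := \sum_(a <- S) u a in T0 ub.
have [S' [t [S'S iS' ht t0]]] : exists S' t, [/\ {subset S' <= S},
    affinely_independent S', is_bary (S', b) t & forall a, a \in S' -> 0 < t a].
  apply: (@Caratheodory _ _ S b (fun a => T^-1 * u a)).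
  - by move=> a /u0/ltW ua; rewrite mulr_ge0 // invr_ge0 ltW.
  - by rewrite -mulr_sumr mulVf // gt_eqF.
  - under eq_bigr do rewrite -scalerA.
    by rewrite -scaler_sumr ub scalerA mulVf ?scale1r // gt_eqF.
have [/= tS t1 tb] := ht.
have ex : exists2 a, a \in S' & 0 < t a.
  have [S'0|[a aS']] := fset_0Vmem S'; last by exists a => //; exact: t0.
  by move: t1; rewrite S'0 big_seq_fset0 => /eqP; rewrite eq_sym oner_eq0.
have [a0 [a0S' ta0 hmin]] := min_ratio ex (fun a aS => ltW (u0 a (S'S a aS))).
set k := u a0 / t a0 in hmin; have k0 : 0 < k by rewrite divr_gt0 // u0 // S'S.
pose v a := u a - k * t a.
have v0 a : 0 <= v a.
  have [/hmin|/tS ta] := boolP (a \in S'); first by rewrite subr_ge0.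
  rewrite /v ta mulr0 subr0; have [/u0/ltW//|/uS->//] := boolP (a \in S).
have va0 : v a0 = 0 by rewrite /v /k divfK ?subrr // gt_eqF.
pose S'' := [fset a in S | 0 < v a]%fset.
have memS'' a : (a \in S'') = (a \in S) && (0 < v a) by rewrite !inE.
have S''S : {subset S'' <= S} by move=> a; rewrite memS'' => /andP[].
have vS'' a : a \notin S'' -> v a = 0.
  rewrite memS'' negb_and => /orP[aS|].
    by rewrite /v uS // tS ?mulr0 ?subr0 //; apply: contra aS => /S'S.
  by rewrite -leNgt => va; apply/le_anti; rewrite va v0.
have sumS'' (V : lmodType R) (F : 'rV[R]_n -> V) : \sum_(a <- S'') v a *: F a =
    \sum_(a <- S) u a *: F a - k *: \sum_(a <- S') t a *: F a.
  rewrite (big_fset_incl _ (B := S)); last 2 first.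
  - exact/fsubsetP.
  - by move=> a _ /vS''->; rewrite scale0r.
  rewrite (big_fset_incl _ (A := S') (B := S)); last 2 first.
  - exact/fsubsetP.
  - by move=> a _ /tS->; rewrite scale0r.
  rewrite scaler_sumr -sumrB; apply: eq_bigr => a _.
  by rewrite scalerBl scalerA.
have sumS1 (F : 'rV[R]_n -> R) : \sum_(a <- S'') v a * F a =
    \sum_(a <- S) u a * F a - k * \sum_(a <- S') t a * F a.
  exact: (sumS'' R^o F).
have [||||||k' [k'0 k'le hk']] := IH S'' v.
- apply: (@leq_trans #|` S|); last exact: SN.
  apply: fproper_ltn_card; rewrite /fproper.
  apply/andP; split; first exact/fsubsetP.
  by apply/fsubsetPn; exists a0; [exact: S'S|rewrite memS'' va0 ltxx andbF].
- by move=> a /S''S/SA.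
- by apply: contra bS => /S''S.
- exact: vS''.
- by move=> a; rewrite memS'' => /andP[].
- rewrite (sumS'' _ id) ub tb -scalerBl; congr (_ *: _).
  have := sumS1 (fun=> 1); rewrite !(eq_bigr _ (fun a _ => mulr1 _)).
  by rewrite t1 mulr1 => ->.
have hS' : circuit_over A S' b t.
  by split=> // [a /S'S/SA//|]; apply: contra bS => /S'S.
set k1 := k * expR (\sum_(a <- S') t a * ln (w a)).
have k10 : 0 < k1 by rewrite mulr_gt0 ?expR_gt0.
have kk0 : 0 < k1 + k' by rewrite ltr_pwDl.
exists (k1 + k'); split; first exact: ltW.
- have := sumS1 (fun a => 1 + ln (w a)) => /eqP;
  rewrite eq_sym subr_eq => /eqP->.
  rewrite addrC lerD // /k1 ler_wpM2l ?(ltW k0) //.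
  under eq_bigr do rewrite mulrDr mulr1.
  by rewrite big_split /= t1 expR_ge1Dx.
(* Sharing [e] in the ratio of [k1] to [k'] keeps each share within its own bound. *)
- move=> e he; pose e1 := e * k1 / (k1 + k'); pose e2 := e * k' / (k1 + k').
  have small x : 0 <= x -> `|e * x / (k1 + k')| <= x.
    move=> x0; rewrite normrM normfV normrM (ger0_norm x0) (gtr0_norm kk0).
    by rewrite ler_pdivrMr // mulrC ler_wpM2l.
  have h1 := soc_cone_simplex hS' bAB w0 (ltW k0) (small _ (ltW k10)).
  have h2 := hk' e2 (small _ k'0).
  apply: eq_soc_cone (soc_coneD h1 h2) => g.
  have -> : u g = v g + k * t g by rewrite /v subrK.
  have -> : e * (g == b)%:R = (e1 + e2) * (g == b)%:R.
    by congr (_ * _); rewrite /e1 /e2 -mulrDl -mulrDr mulfK // gt_eqF.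
  rewrite -/k1 -/e1; ring.
Qed.

End SocCone.

(** * Entropy certificates *)

Section EntropyCertificate.
Variable R : realType.

(** With [s] the root of [x], [- ln s <= 1/s] gives [- x ln x = 2 s^2 (- ln s) <= 2 s]. *)
Lemma mul_ln_le_sqrt (x : R) : 0 < x < 1 -> `|x * ln x| <= 2 * Num.sqrt x.
Proof.
move=> /andP[x0 x1]; set s := Num.sqrt x.
have s0 : 0 < s by rewrite sqrtr_gt0.
have xs : x = s ^+ 2 by rewrite sqr_sqrtr // ltW.
have lnx : ln x = 2 * ln s by rewrite xs expr2 lnM ?posrE //; ring.
have lns : - ln s <= s^-1.
  rewrite -lnV ?posrE //; have si0 : 0 < s^-1 by rewrite invr_gt0.
  have := @le_ln1Dx R (s^-1 - 1); rewrite addrCA subrr addr0.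
  by move=> h; apply: le_trans (h _) _; rewrite ?ltrBrDl ?subrr // gerBl.
have ln0 : ln x <= 0 by apply: ln_le0; exact: ltW.
rewrite normrM (gtr0_norm x0) (ler0_norm ln0) lnx {1}xs.
have -> : s ^+ 2 * - (2 * ln s) = 2 * (s ^+ 2 * - ln s) by ring.
rewrite ler_wpM2l //; apply: (le_trans (ler_wpM2l _ lns)); first exact: sqr_ge0.
by rewrite expr2 mulfK // gt_eqF.
Qed.

(** To the left of 0 the function is constant, as [ln] is 0 on nonpositive numbers; from the right
    at 0 the square-root bound applies. *)
Lemma mul_ln_continuous : continuous (fun x : R => x * ln x).
Proof.
move=> x; have [x0|x0|->] := ltgtP x 0.
- rewrite /continuous_at; have -> : x * ln x = 0 by rewrite ln0 ?mulr0 // ltW.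
  apply: cvg_near_cst; near=> z; rewrite ln0 ?mulr0 //.
  by apply/ltW; near: z; exact: lt_nbhsl.
- by apply: cvgM; [exact: cvg_id|exact: continuous_ln].
- rewrite /continuous_at mul0r; apply/cvgrPdist_lt => e e0.
  have d0 : 0 < Num.min 1 ((e / 2) ^+ 2) by rewrite lt_min ltr01 exprn_gt0 //
    divr_gt0.
  near=> z; rewrite sub0r normrN; have [z0|z0] := leP z 0.
    by rewrite ln0 // mulr0 normr0.
  have : `|z| < Num.min 1 ((e / 2) ^+ 2).
    near: z; exists (Num.min 1 ((e / 2) ^+ 2)) => //= z.
    by rewrite /ball_ /= sub0r normrN.
  rewrite (gtr0_norm z0) lt_min => /andP[z1 ze].
  apply: (le_lt_trans (mul_ln_le_sqrt _)); first by rewrite z0.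
  rewrite mulrC -ltr_pdivlMr // -(@ltr_pXn2r _ 2) ?nnegrE ?sqrtr_ge0 ?divr_ge0
    ?ltW //.
  by rewrite sqr_sqrtr // ltW.
Unshelve. all: by end_near. Qed.

Lemma is_derive_mull (a t : R) : is_derive t (1 : R) (fun x => a * x) a.
Proof.
have := @is_deriveZ R R R id a t 1 1 (is_derive_id t 1).
by rewrite -[a *: 1]/(a * 1) mulr1.
Qed.

Lemma is_derive_expR_mull (a t : R) :
  is_derive t (1 : R) (fun x => expR (a * x)) (expR (a * t) * a).
Proof.
exact: (@is_derive1_comp _ expR (fun x => a * x) _ _ _ (is_derive_expR _)
  (is_derive_mull a t)).
Qed.

Lemma is_derive_sqr (t : R) : is_derive t (1 : R) (fun x => x * x) (t + t).
Proof.
have := @is_deriveM R R id id t 1 1 1 (is_derive_id t 1) (is_derive_id t 1).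
by rewrite -[t *: 1]/(t * 1) mulr1.
Qed.

Lemma continuous_mul_rV n (f g : 'rV[R]_n -> R) :
  continuous f -> continuous g -> continuous (fun x => f x * g x).
Proof. by move=> cf cg x; apply: continuousM; [exact: cf|exact: cg]. Qed.

Lemma continuous_add_rV n (f g : 'rV[R]_n -> R) :
  continuous f -> continuous g -> continuous (fun x => f x + g x).
Proof. by move=> cf cg x; apply: continuousD; [exact: cf|exact: cg]. Qed.

Lemma continuous_sum_rV n k (f : 'I_k -> 'rV[R]_n -> R) :
  (forall i, continuous (f i)) -> continuous (fun x => \sum_i f i x).
Proof.
by move=> cf; apply: continuous_big => [|i _];
  [exact: add_continuous|exact: cf].
Qed.

Lemma continuous_coord_rV n (j : 'I_n) : continuous (fun x : 'rV[R]_n => x 0 j).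
Proof. by move=> x; exact: coord_continuous. Qed.

Lemma continuous_cst_rV n (k : R) : continuous (fun x : 'rV[R]_n => k).
Proof. by move=> x; exact: cst_continuous. Qed.

Variables (N n : nat) (v : 'I_N -> 'rV[R]_n) (c : 'I_N -> R) (d : R).
Hypotheses (c0 : forall i, 0 < c i)
  (hd : forall y, d <= \sum_i c i * expR (dot y (v i))).

Let G := \sum_i c i.

(* Minimises [y |-> \sum_i c_i e^<y, v_i> + e |y|^2]. *)
Lemma approximate_certificate (e : R) : 0 < e -> exists u : 'I_N -> R,
  [/\ forall i, 0 <= u i <= G, d <= \sum_i u i * (1 + ln (c i / u i)) &
      \sum_j (\sum_i u i * v i 0 j) ^+ 2 <= 4 * e * G].
Proof.
move=> e0.
have G0 : 0 <= G by apply: sumr_ge0 => i _; exact: ltW.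
pose h (y : 'rV[R]_n) := \sum_i c i * expR (dot y (v i)) + e * \sum_j y 0 j ^+
  2.
(* Since [K >= 1] and [K >= G / e], outside the box of radius [K] the penalty alone exceeds
   [h 0 = G], so a minimiser on the box is global. *)
pose K := 1 + G / e.
have K1 : 1 <= K by rewrite lerDl divr_ge0 // ltW.
have eK : G <= e * K ^+ 2.
  rewrite mulrC -ler_pdivrMr //; apply: (@le_trans _ _ K).
    by rewrite lerDr.
  by rewrite expr2 ler_peMl // (le_trans ler01).
have dotC (y z : 'rV[R]_n) : dot y z = dot z y.
  by apply: eq_bigr => j _; rewrite mulrC.
have expC z : continuous (fun y : 'rV[R]_n => expR (dot y z)).
  move=> y; apply: (@continuous_comp _ _ _ (fun y => dot y z));
    last exact: continuous_expR.
  have -> : (fun y => dot y z) = dot z by apply/funext => x.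
  exact: dot_continuous.
have hC : continuous h.
  apply: continuous_add_rV.
    apply: continuous_sum_rV => i; apply: continuous_mul_rV (expC _).
    exact: continuous_cst_rV.
  apply: continuous_mul_rV; first exact: continuous_cst_rV.
  apply: continuous_sum_rV => j.
  by apply: continuous_mul_rV; exact: continuous_coord_rV.
have cK : compact [set y : 'rV[R]_n | forall j, `[- K, K]%classic (y 0 j)].
  by apply: (@rV_compact R n (fun=> `[- K, K]%classic)) => j;
    exact: segment_compact.
have g0 y : 0 <= \sum_i c i * expR (dot y (v i)).
  by apply: sumr_ge0 => i _; rewrite mulr_ge0 ?expR_ge0 // ltW.
have h0 : h 0 = G.
  rewrite /h [X in e * X]big1 ?mulr0 ?addr0 => [|j _];
    last by rewrite mxE expr0n.
  apply: eq_bigr => i _; rewrite /dot big1 ?expR0 ?mulr1 // => j _.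
  by rewrite mxE mul0r.
have [|y yK ymin] := EVT_min_rV _ cK (continuous_subspaceT hC).
  by exists 0 => j /=; rewrite in_itv /= mxE oppr_le0 (le_trans ler01).
have hy : h y <= G.
  rewrite -h0; apply: ymin; rewrite inE => j /=.
  by rewrite in_itv /= mxE oppr_le0 (le_trans ler01).
have {}ymin z : h y <= h z.
  have [zK|] := pselect (forall j, `[- K, K]%classic (z 0 j)).
    by apply: ymin; rewrite inE.
  move=> /existsNP[j /=]; rewrite in_itv /= -ler_norml => /negP;
    rewrite -ltNge => Kz.
  apply: (le_trans hy); apply: (le_trans eK).
  have Kz2 : K ^+ 2 <= \sum_j z 0 j ^+ 2.
    rewrite (bigD1 j) //= -[leLHS]addr0; apply: lerD.
      rewrite -[leRHS]real_normK ?num_real // lerXn2r ?nnegrE ?(ltW Kz) //.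
      exact: le_trans ler01 K1.
    by apply: sumr_ge0 => k _; exact: sqr_ge0.
  apply: (@le_trans _ _ (e * \sum_j z 0 j ^+ 2));
    first by rewrite ler_wpM2l // ltW.
  by rewrite lerDr.
pose u i := c i * expR (dot y (v i)).
have u0 i : 0 < u i by rewrite mulr_gt0 ?expR_gt0.
have ey : e * \sum_j y 0 j ^+ 2 <= G.
  by apply: le_trans hy; rewrite lerDr.
have uG i : u i <= G.
  apply: le_trans hy; rewrite /h (bigD1 i) //= -addrA lerDl addr_ge0 //.
    by apply: sumr_ge0 => k _; rewrite mulr_ge0 ?expR_ge0 // ltW.
  by rewrite mulr_ge0 ?(ltW e0) // sumr_ge0 // => j _; exact: sqr_ge0.
(* Stationarity at [y] in direction [j]: up to a constant, [F] below is [h] along that line, so its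
   derivative at 0 vanishes. *)
have grad j : \sum_i u i * v i 0 j = - (2 * e * y 0 j).
  pose f i (t : R) : R := u i * expR (v i 0 j * t).
  pose g (t : R) : R := 2 * e * y 0 j * t + e * (t * t).
  pose F (t : R) : R := \sum_i f i t + g t.
  have df (t : R) : is_derive t (1 : R) F (\sum_i u i * (expR (v i 0 j * t) * v
    i 0 j) +
      (2 * e * y 0 j + e * (t + t))).
    have -> : F = \sum_i f i + g by apply/funext => x; rewrite /F fctE fct_sumE.
    apply: is_deriveD.
      apply: is_derive_sum => i.
      exact: (@is_deriveZ _ _ _ _ (u i) t 1 _ (is_derive_expR_mull (v i 0 j)
        t)).
    apply: (@is_deriveD _ _ _ (fun t => 2 * e * y 0 j * t) (fun t => e * (t *
      t))).
      exact: is_derive_mull.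
    exact: (@is_deriveZ _ _ _ _ e t 1 _ (is_derive_sqr t)).
  have dotd z : dot z (delta_mx 0 j) = z 0 j.
    rewrite /dot (bigD1 j) //= mxE !eqxx mulr1 big1 ?addr0 // => k kj.
    by rewrite mxE (negbTE kj) andbF mulr0.
  have fE t : F t = h (y + t *: delta_mx 0 j) - e * \sum_j y 0 j ^+ 2.
    rewrite /h; have -> : \sum_k (y + t *: delta_mx 0 j) 0 k ^+ 2 =
        \sum_k y 0 k ^+ 2 + 2 * y 0 j * t + t * t.
      rewrite (bigD1 j) //= [in RHS](bigD1 j) //= !mxE !eqxx mulr1.
      rewrite (eq_bigr (fun k => y 0 k ^+ 2)); first by ring.
      by move=> k kj; rewrite !mxE (negbTE kj) andbF mulr0 addr0.
    have -> : \sum_i c i * expR (dot (y + t *: delta_mx 0 j) (v i)) = \sum_i f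
      i t.
      apply: eq_bigr => i _; rewrite /f /u -mulrA -expRD; congr (_ * expR _).
      by rewrite dotC dotDr dotZr dotd dotC [t * _]mulrC.
    by rewrite /F /g; ring.
  have F0 : is_derive (0 : R) (1 : R) F 0.
    apply: (@derive1_at_min _ _ (-1) 1) => //.
    - by rewrite in_itv /= ltrN10 ltr01.
    - by move=> t _; rewrite !fE scale0r addr0 lerB.
  have := @derive_val _ _ _ _ _ _ _ (df 0);
    rewrite (@derive_val _ _ _ _ _ _ _ F0).
  rewrite addr0 mulr0 addr0 => /esym/eqP; rewrite addr_eq0 => /eqP <-.
  by apply: eq_bigr => i _; rewrite mulr0 expR0 mul1r.
exists u; split.
- by move=> i; rewrite uG ltW.
(* [ln (c i / u i)] is [- dot y (v i)]; by [grad] these terms contribute [2 e |y|^2], so the entropy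
   sum is at least the unpenalised sum at [y]. *)
- have -> : \sum_i u i * (1 + ln (c i / u i)) = \sum_i u i + 2 * (e * \sum_j y
  0 j ^+ 2).
    transitivity (\sum_i u i - \sum_i u i * dot y (v i)).
      rewrite -sumrB; apply: eq_bigr => i _;
        rewrite {2}/u invfM mulrA divff ?gt_eqF //.
      by rewrite mul1r -expRN expRK mulrDr mulr1 mulrN.
    congr (_ + _); under eq_bigr do rewrite mulr_sumr.
    rewrite exchange_big mulrCA mulr_sumr -sumrN mulr_sumr;
      apply: eq_bigr => j _ /=.
    under eq_bigr do rewrite mulrCA.
    by rewrite -mulr_sumr grad; ring.
  apply: (le_trans (hd y)); rewrite lerDl mulr_ge0 // mulr_ge0 ?(ltW e0) //.
  by apply: sumr_ge0 => j _; exact: sqr_ge0.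
- under eq_bigr do rewrite grad sqrrN exprMn.
  rewrite -mulr_sumr; have -> : (2 * e) ^+ 2 * \sum_j y 0 j ^+ 2 =
    4 * e * (e * \sum_j y 0 j ^+ 2) by ring.
  by rewrite ler_wpM2l // mulr_ge0 // ltW.
Qed.

(** Compactness replaces the limit of vanishing penalty: on the compact set of bounded weights
    satisfying the entropy bound, the squared norm of [\sum_i u i *: v i] attains its minimum, and
    it takes arbitrarily small values there. *)
Lemma entropy_certificate : exists u : 'I_N -> R,
  [/\ forall i, 0 <= u i, \sum_i u i *: v i = 0 &
      d <= \sum_i u i * (1 + ln (c i / u i))].
Proof.
(* The entropy sum written without quotients, hence continuous also where a weight is 0. *)
pose E (u : 'rV[R]_N) := \sum_i (u 0 i * (1 + ln (c i)) - u 0 i * ln (u 0 i)).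
pose F (u : 'rV[R]_N) := \sum_j (\sum_i u 0 i * v i 0 j) ^+ 2.
have EE (u : 'rV[R]_N) : (forall i, 0 <= u 0 i) ->
    E u = \sum_i u 0 i * (1 + ln (c i / u 0 i)).
  move=> u0; apply: eq_bigr => i _; have := u0 i; rewrite le_eqVlt.
  move=> /orP[/eqP<-|ui]; first by rewrite !mul0r subrr.
  by rewrite ln_div ?posrE //; ring.
have EC : continuous E.
  apply: continuous_sum_rV => i.
  have -> : (fun x : 'rV[R]_N => x 0 i * (1 + ln (c i)) - x 0 i * ln (x 0 i)) =
      (fun x => x 0 i * (1 + ln (c i)) + -1 * (x 0 i * ln (x 0 i))).
    by apply/funext => x; rewrite mulN1r.
  apply: continuous_add_rV; apply: continuous_mul_rV;
    try exact: continuous_cst_rV.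
    exact: continuous_coord_rV.
  move=> x; apply: (@continuous_comp _ _ _ (fun x : 'rV[R]_N => x 0 i)
    (fun x => x * ln x)); first exact: coord_continuous.
  exact: mul_ln_continuous.
have FC : continuous F.
  apply: continuous_sum_rV => j.
  have C : continuous (fun x : 'rV[R]_N => \sum_i x 0 i * v i 0 j).
    apply: continuous_sum_rV => i; apply: continuous_mul_rV.
      exact: continuous_coord_rV.
    exact: continuous_cst_rV.
  exact: (continuous_mul_rV C C).
pose D := ([set u : 'rV[R]_N | forall i, `[0, G]%classic (u 0 i)] `&`
  E @^-1` [set x | d <= x])%classic.
have cD : compact D.
  apply: compact_closedI.
    by apply: (@rV_compact R N (fun=> `[0, G]%classic)) => j;
      exact: segment_compact.
  by apply: closed_comp => [x _|]; [exact: EC|exact: closed_ge].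
have hD e : 0 < e -> exists2 u, D u & F u <= 4 * e * G.
  move=> /approximate_certificate[u [uG Eu Fu]]; exists (\row_i u i).
    split=> [i|/=]; first by rewrite /= in_itv /= mxE.
    rewrite EE; last by move=> i; rewrite mxE; case/andP: (uG i).
    by under eq_bigr do rewrite mxE.
  by rewrite /F; under eq_bigr do under eq_bigr do rewrite mxE.
have [|u uD umin] := EVT_min_rV _ cD (continuous_subspaceT FC).
  by have [u Du _] := hD _ ltr01; exists u.
move: uD; rewrite inE => -[ubox Eu].
have u0 i : 0 <= u 0 i by have := ubox i; rewrite /= in_itv /= => /andP[].
have F0 : 0 <= F u by apply: sumr_ge0 => j _; exact: sqr_ge0.
have G0 : 0 <= G by apply: sumr_ge0 => i _; exact: ltW.
have Fu0 : F u = 0.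
  apply/eqP; rewrite eq_le F0 andbT; apply/ler_addgt0Pl => e e0; rewrite addr0.
  have G1 : 0 < 4 * (G + 1) by rewrite mulr_gt0 // ltr_wpDl.
  (* This penalty makes the bound [4 e G] at most [e]; [G + 1] avoids dividing by 0. *)
  have [w Dw Fw] := hD (e / (4 * (G + 1))) (divr_gt0 e0 G1).
  have wD : w \in D by rewrite inE.
  apply: (le_trans (umin w wD)); apply: (le_trans Fw).
  have -> : 4 * (e / (4 * (G + 1))) * G = e * (G / (G + 1)).
    by field; rewrite gt_eqF // ltr_wpDl.
  by rewrite ler_piMr ?ltW // ltr_pdivrMr ?mul1r ?ltrDl // ltr_wpDl.
exists (fun i => u 0 i); split=> //; last by rewrite -EE.
apply/rowP => j; rewrite summxE mxE; apply/eqP; rewrite -sqrf_eq0.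
move: Fu0 => /eqP; rewrite psumr_eq0 => [/allP/(_ j)|k _]; last exact: sqr_ge0.
rewrite mem_index_enum => /(_ isT); congr (_ ^+ 2 == 0).
by apply: eq_bigr => i _; rewrite mxE.
Qed.

End EntropyCertificate.

(** * From nonnegative AG functions to circuit vectors and back *)

Section NonnegativeAG.
Variables (R : realType) (n : nat) (A B : {fset 'rV[R]_n}).
Let AB := (A `|` B)%fset.
Variable (arr : circuit R n -> seq (option 'rV[R]_n)).
Hypotheses (Aq : forall a, a \in A -> rational_exponent a)
  (Bn : forall b, b \in B -> natural_exponent b)
  (Bodd : forall b : 'rV[R]_n, b \in B -> ~ even_exponent b)
  (AB0 : (A `&` B)%fset = fset0)
  (arrP : forall q, q \in reduced_circuits A AB -> perm_eq (arr q) (labels q)).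
Implicit Types (c : 'rV[R]_n -> R) (a b y : 'rV[R]_n).

Lemma union_rational a : a \in AB -> rational_exponent a.
Proof. by rewrite in_fsetU => /orP[/Aq//|/Bn/natural_rational]. Qed.

(** Division by [e^<y, b>] turns the hypothesis into the input of the entropy certificate for the
    vectors [a - b]; its weights, with [w = c / u], are the measure decomposed by
    [soc_cone_measure]. *)
Lemma soc_cone_AG c b : b \in AB -> (forall g, g \notin A -> g != b -> c g = 0)
  ->
  (forall a, a \in A -> a != b -> 0 <= c a) ->
  (forall y, `|c b| * expR (dot y b) <=
     \sum_(a <- A | a != b) c a * expR (dot y a)) ->
  soc_cone A B arr c.
Proof.
move=> bAB sc c0 hc; pose S := [fset a in A | (a != b) && (0 < c a)]%fset.
have memS a : (a \in S) = [&& a \in A, a != b & 0 < c a] by rewrite !inE.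
pose v (i : 'I_(size S)) := S`_i - b; pose cS (i : 'I_(size S)) := c S`_i.
have inS (i : 'I_(size S)) : S`_i \in S by exact: mem_nth.
have cS0 i : 0 < cS i by have := inS i; rewrite memS => /and3P[].
have hd y : `|c b| <= \sum_i cS i * expR (dot y (v i)).
  have E : \sum_(a <- A | a != b) c a * expR (dot y a) =
      \sum_i cS i * expR (dot y S`_i).
    rewrite -(sum_fset_ord S (fun a => c a * expR (dot y a))).
    rewrite big_mkcond; symmetry.
    rewrite (eq_big_seq (fun a => if a != b then c a * expR (dot y a) else 0)).
      apply: big_fset_incl; first by apply/fsubsetP => a;
        rewrite memS => /and3P[].
      move=> a aA; rewrite memS aA /=; case: eqP => //= /eqP ab;
        rewrite lt0r c0 // andbT negbK.
      by move=> /eqP->; rewrite mul0r.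
    by move=> a; rewrite memS => /and3P[_ -> _].
  rewrite -(ler_pM2r (expR_gt0 (dot y b))); apply: (le_trans (hc y)); rewrite E.
  rewrite mulr_suml; apply: ler_sum => i _; rewrite -mulrA -expRD.
  by rewrite dotDr dotNr subrK.
have [u [u0 uv ud]] := entropy_certificate cS0 hd.
have [t /rowP tu] := row_nth_fset (\row_i u i).
have {}tu i : u i = t S`_i by have := tu i; rewrite !mxE.
have t0 a : a \in S -> 0 <= t a.
  move=> aS; have ia : (index a S < size S)%N by rewrite index_mem.
  by have := u0 (Ordinal ia); rewrite tu /= nth_index.
pose U := [fset a in S | 0 < t a]%fset.
have memU a : (a \in U) = (a \in S) && (0 < t a) by rewrite !inE.
have US : {subset U <= S} by move=> a; rewrite memU => /andP[].
have t0U a : a \in S -> a \notin U -> t a = 0.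
  by move=> aS; rewrite memU aS /= -leNgt => ta; apply/le_anti; rewrite ta t0.
(* On [U] the product [nu a * w a] recovers [c a]; off [U] the value 1 keeps [w] positive. *)
pose nu a := if a \in U then t a else 0;
  pose w a := if a \in U then c a / t a else 1.
have nuU a : a \in U -> nu a = t a by rewrite /nu => ->.
have nuv : \sum_(a <- U) nu a *: a = (\sum_(a <- U) nu a) *: b.
  apply/eqP; rewrite -subr_eq0 scaler_suml -sumrB; apply/eqP.
  rewrite -[RHS]uv (eq_big_seq (fun a => t a *: (a - b))); last first.
    by move=> a aU; rewrite nuU // scalerBr.
  rewrite (eq_bigr (fun i : 'I_(size S) => t S`_i *: (S`_i - b))); last first.
    by move=> i _; rewrite tu.
  rewrite -(sum_fset_ord S (fun a => t a *: (a - b))); apply: big_fset_incl.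
    exact/fsubsetP.
  by move=> a aS aU; rewrite t0U // scale0r.
have [||||||k [_ kle hk]] := @soc_cone_measure _ _ A B arr Aq union_rational
  AB0 arrP b U nu w bAB.
- move=> a; rewrite /w; case: ifP => // aU; rewrite divr_gt0 //.
    by have := US _ aU; rewrite memS => /and3P[].
  by move: aU; rewrite memU => /andP[].
- by move=> a /US; rewrite memS => /and3P[].
- by apply/negP => /US; rewrite memS eqxx andbF.
- by move=> a aU; rewrite /nu (negbTE aU).
- by move=> a aU; rewrite nuU //; move: aU; rewrite memU => /andP[].
- exact: nuv.
have ek : `|c b| <= k.
  apply: le_trans kle; apply: (le_trans ud); rewrite le_eqVlt; apply/orP;
    left; apply/eqP.
  rewrite (eq_bigr (fun i : 'I_(size S) => t S`_i * (1 + ln (c S`_i / t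
    S`_i)))); last first.
    by move=> i _; rewrite tu.
  rewrite -(sum_fset_ord S (fun a => t a * (1 + ln (c a / t a)))); symmetry.
  rewrite (eq_big_seq (fun a => t a * (1 + ln (c a / t a)))); last first.
    by move=> a aU; rewrite nuU // /w aU.
  apply: big_fset_incl; first exact/fsubsetP.
  by move=> a aS aU; rewrite t0U // mul0r.
(* Coefficients without weight in the certificate remain as nonnegative monomials. *)
pose rest g := if (g \in A) && (g != b) && (g \notin U) then c g else 0.
have hrest : soc_cone A B arr rest.
  apply: soc_cone_nonneg => //.
    by move=> g gA; rewrite /rest (negbTE gA).
  by move=> a aA; rewrite /rest; case: ifP => // /andP[/andP[_ ab] _];
    exact: c0.
apply: eq_soc_cone (soc_coneD (hk (c b) ek) hrest) => g.
have [gU|gU] := boolP (g \in U).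
  have := US _ gU; rewrite memS => /and3P[gA gb _];
    rewrite nuU // /w /rest gU andbF.
  rewrite (negbTE gb) mulr0 !addr0 mulrC divfK // gt_eqF //.
  by move: gU; rewrite memU => /andP[].
rewrite /nu /rest (negbTE gU) mul0r add0r andbT.
have [->|gb] := eqVneq g b; first by rewrite andbF mulr1 addr0.
by rewrite mulr0 add0r andbT; case: ifP => // /negbT gA; rewrite sc.
Qed.

Lemma abs_monomial_real_expR (x y a : 'rV[R]_n) :
  (forall j, `|x 0 j| = expR (y 0 j)) ->
  ~~ pole x a /\ abs_monomial_real x a = expR (dot y a).
Proof.
move=> hx; split.
  apply/existsP => -[j /andP[/eqP xj _]]; have := expR_gt0 (y 0 j).
  by rewrite -hx xj normr0 ltxx.
rewrite /dot expR_sum; apply: eq_bigr => j _; by rewrite hx expRM.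
Qed.

(** Evaluation at points with [|x_j| = e^(y_j)] avoids poles and gives the exponential inequality of
    [soc_cone_AG], with [b] the exponent of the exceptional term; without such a term all
    coefficients are nonnegative. *)
Lemma nonneg_AG_soc_cone c : nonneg_AG A B c -> soc_cone A B arr c.
Proof.
move=> [sc hAG c0].
have signo (x y : 'rV[R]_n) : (forall j, `|x 0 j| = expR (y 0 j)) ->
    0 <= \sum_(a <- A) c a * expR (dot y a) + \sum_(b <- B) c b * monomial x b.
  move=> hx; have := c0 x; rewrite signomial_finite; last first.
    by move=> a _ _; exact: (abs_monomial_real_expR a hx).1.
  rewrite lee_fin; congr (0 <= _ + _); apply: eq_bigr => a _.
  by rewrite (abs_monomial_real_expR a hx).2.
have nonneg : (forall a, a \in A -> 0 <= c a) -> (forall b, b \in B -> c b = 0)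
  ->
    soc_cone A B arr c.
  move=> cA cB; apply: soc_cone_nonneg => // g gA;
    have [/cB//|gB] := boolP (g \in B).
  by rewrite sc // in_fsetU negb_or gA.
case: hAG => -[h1 h2].
- have [[b bA cb]|hA] := pselect (exists2 b, b \in A & c b < 0); last first.
    apply: nonneg => // a aA; rewrite leNgt; apply/negP => ca; apply: hA;
      by exists a.
  have gB g : g \notin A -> c g = 0.
    by move=> gA; have [/h2//|gB] := boolP (g \in B);
      rewrite sc // in_fsetU negb_or gA.
  apply: (@soc_cone_AG c b); first by rewrite in_fsetU bA.
  + by move=> g /gB.
  + by move=> a aA ab; rewrite leNgt; apply/negP => ca;
    rewrite (h1 a b) // eqxx in ab.
  + move=> y; have hx j : `|(\row_j expR (y 0 j)) 0 j| = expR (y 0 j) :> R.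
      by rewrite mxE ger0_norm // expR_ge0.
    have := signo _ _ hx.
    have -> : \sum_(b <- B) c b * monomial (\row_j expR (y 0 j)) b = 0.
      by rewrite big_seq big1 // => g /h2->; rewrite mul0r.
    rewrite addr0.
    by rewrite (bigD1_seq b) ?fset_uniq //= ltr0_norm // mulNr -lerBlDl sub0r.
- have [[b bB cb]|hB] := pselect (exists2 b, b \in B & c b != 0); last first.
    apply: nonneg => // b bB; apply/eqP; apply: contrapT => /negP cb;
      apply: hB; by exists b.
  have bA : b \notin A.
    by apply/negP => bA; have := in_fset0 b; rewrite -AB0 in_fsetI bA bB.
  have cB g : g \in B -> g != b -> c g = 0.
    by move=> gB gb; apply/eqP; apply: contraNT gb => cg; rewrite (h2 g b).
  apply: (@soc_cone_AG c b); first by rewrite in_fsetU bB orbT.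
  + move=> g gA gb; have [gB|gB] := boolP (g \in B); first exact: cB.
    by rewrite sc // in_fsetU negb_or gA.
  + by move=> a aA _; exact: h1.
  + have /choice[k hk] := Bn bB.
    (* As [b] is not even, it has an odd coordinate; giving [x] the appropriate sign there makes the
       term at [b] equal to [- |c b| e^<y, b>]. *)
    have [j0 kj0] : exists j0, odd (k j0).
      apply: contrapT => hj; apply: (Bodd bB) => j; exists (k j)./2.
      rewrite hk mul2n -[in LHS](odd_double_half (k j)).
      by case E : (odd (k j)) => //; case: hj; exists j.
    move=> y; pose e j : R := if (j == j0) && (0 < c b) then -1 else 1.
    have hx j : `|(\row_j (e j * expR (y 0 j))) 0 j| = expR (y 0 j) :> R.
      rewrite mxE normrM (ger0_norm (expR_ge0 _)) /e; case: ifP => _.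
        by rewrite normrN1 mul1r.
      by rewrite normr1 mul1r.
    have := signo _ _ hx.
    have -> : \sum_(b <- B) c b * monomial (\row_j (e j * expR (y 0 j))) b =
        c b * monomial (\row_j (e j * expR (y 0 j))) b.
      rewrite (bigD1_seq b) ?fset_uniq //= big_seq_cond big1 ?addr0 // => g
        /andP[gB gb].
      by rewrite cB // mul0r.
    have -> : monomial (\row_j (e j * expR (y 0 j))) b =
        (if 0 < c b then -1 else 1) * expR (dot y b).
      have -> : expR (dot y b) = \prod_j expR (y 0 j) ^+ k j.
        by rewrite /dot expR_sum; apply: eq_bigr => j _; rewrite hk expRM_natr.
      have -> : (if 0 < c b then -1 else 1) = \prod_j e j ^+ k j :> R.
        rewrite (bigD1 j0) //= big1 ?mulr1 /e ?eqxx /=; last first.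
          by move=> j /negbTE->; rewrite expr1n.
        by case: ifP => _; [rewrite -signr_odd kj0|rewrite expr1n].
      rewrite -big_split; apply: eq_bigr => j _ /=.
      by rewrite hk natrK mxE exprMn.
    have -> : c b * ((if 0 < c b then -1 else 1) * expR (dot y b)) =
        - (`|c b| * expR (dot y b)).
      by case: ltrP => cb0; [rewrite gtr0_norm //|rewrite ler0_norm //]; ring.
    rewrite subr_ge0; move=> /le_trans; apply; rewrite le_eqVlt; apply/orP;
      left; apply/eqP.
    rewrite big_seq [RHS]big_seq_cond; apply: eq_bigl => a.
    by case aA : (a \in A) => //=; apply/esym; apply: contraNneq bA => <-.
Qed.

Lemma S_cone0 : S_cone A B (fun=> 0).
Proof.
exists 0%N, (fun=> 0), (fun=> fun=> 0); split; first by case.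
by rewrite big_ord0.
Qed.

Lemma S_coneD c c' : S_cone A B c -> S_cone A B c' -> S_cone A B (c + c').
Proof.
move=> [k [t [g [hg ->]]]] [k' [t' [g' [hg' ->]]]].
pose T i := match fintype.split i with inl j => t j | inr j => t' j end.
pose H i := match fintype.split i with inl j => g j | inr j => g' j end.
exists (k + k')%N, T, H; split=> [i|].
  by rewrite /T /H; case: fintype.split.
rewrite big_split_ord /=; congr (_ + _); apply: eq_bigr => i _; rewrite /T /H.
  by rewrite (unsplitK (inl i)).
by rewrite (unsplitK (inr i)).
Qed.

Lemma nonneg_AG_S_cone c : nonneg_AG A B c -> S_cone A B c.
Proof.
move=> hc; exists 1%N, (fun=> 1), (fun=> c); split; first by [].
by rewrite big_ord1 scale1r.
Qed.

Lemma S_cone_sum (I : Type) (r : seq I) (P : pred I) (F : I -> 'rV[R]_n -> R) :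
  (forall i, P i -> S_cone A B (F i)) ->
  S_cone A B (fun g => \sum_(i <- r | P i) F i g).
Proof.
move=> hF; elim: r => [|i r IH].
  by under eq_fun do rewrite big_nil; exact: S_cone0.
under eq_fun do rewrite big_cons; case Pi : (P i) => //.
exact: (S_coneD (hF i Pi) IH).
Qed.

Lemma nonneg_AG_monomial a r : a \in A -> 0 <= r ->
  nonneg_AG A B (fun g => r * (g == a)%:R).
Proof.
move=> aA r0; have d0 g : 0 <= r * (g == a)%:R by rewrite mulr_ge0.
have aB b : b \in B -> b != a.
  by move=> bB; apply/eqP => ba; have := in_fset0 a;
    rewrite -AB0 in_fsetI aA -ba bB.
split.
- move=> g; rewrite in_fsetU negb_or => /andP[gA _]; case: eqP => [ga|];
  rewrite ?mulr0 //.
  by rewrite ga aA in gA.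
- by left; split=> [g g' _ _|b /aB/negbTE->]; [rewrite ltNge d0|rewrite mulr0].
- move=> x; have [/andP[xa r1]|np] := boolP (pole x a && (0 < r)).
    by rewrite (@signomial_pole R n A B _ x a) // eqxx mulr1.
  rewrite signomial_finite.
    rewrite lee_fin addr_ge0 //.
      by apply: sumr_ge0 => g _; rewrite mulr_ge0 ?abs_monomial_real_ge0.
    by rewrite big_seq sumr_ge0 // => b /aB/negbTE->; rewrite mulr0 mul0r.
  move=> g _; case: (eqVneq g a) => [->|_];
    rewrite ?mulr0 ?eqxx // mulr1 => rn0.
  by move: np; rewrite lt0r rn0 r0 !andbT.
Qed.

(** Each circuit part is itself a nonnegative AG function, and each uncovered exponent contributes a
    nonnegative monomial; the circuit parts vanish there. *)
Lemma soc_cone_S_cone c : soc_cone A B arr c -> S_cone A B c.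
Proof.
move=> [cc [h1 h2 h3]].
have -> : c = (fun g => \sum_(q <- reduced_circuits A AB | q \in
  reduced_circuits A AB) cc q g) +
    (fun g => \sum_(a <- uncovered A B | a \in uncovered A B) c a * (g ==
      a)%:R).
  apply/funext => g; rewrite -[RHS]/(_ g + _ g) /= -!big_seq.
  have [gU|gU] := boolP (g \in uncovered A B); last first.
    rewrite -h2 //; have -> : \sum_(a <- uncovered A B) c a * (g == a)%:R = 0.
      rewrite big_seq big1 // => a aU.
      by case: eqP => [ga|]; rewrite ?mulr0 // ga aU in gU *.
    by rewrite addr0.
  have [_ gq] := (uncoveredP _ _ _).1 gU.
  rewrite big_seq big1 => [|q qRC]; last first.
    by have [sq _] := h1 q qRC; rewrite sq ?gq.
  rewrite add0r (bigD1_seq g) ?fset_uniq //= eqxx mulr1 big1 ?addr0 // => a ag.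
  by rewrite eq_sym (negbTE ag) mulr0.
apply: S_coneD; apply: S_cone_sum => i iP; apply: nonneg_AG_S_cone.
  have rq := (reduced_circuitsP _ _ _).1 iP.
  exact: (circuit_cone_nonneg_AG Aq Bn AB0 rq (arrP iP) (h1 i iP)).
apply: nonneg_AG_monomial; last exact: h3.
by have [] := (uncoveredP _ _ _).1 iP.
Qed.

Lemma S_cone_soc_cone c : S_cone A B c -> soc_cone A B arr c.
Proof.
move=> [k [t [g [hg ->]]]].
apply: (@eq_soc_cone _ _ _ _ _ (fun x => \sum_i t i * g i x)).
  by move=> x; rewrite fct_sumE; apply: eq_bigr.
apply: soc_cone_sum => i _; have [ti gi] := hg i.
by apply: soc_coneZ => //; exact: nonneg_AG_soc_cone.
Qed.

End NonnegativeAG.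

(** * The second-order cone description of the rational S-cone *)

Theorem corollary4p5 (R : realType) (n : nat) (A B : {fset 'rV[R]_n})
    (A_neq0 : A != fset0)
    (A_rational : forall a : 'rV[R]_n, a \in A -> rational_exponent a)
    (B_natural : forall b : 'rV[R]_n, b \in B -> natural_exponent b)
    (B_noteven : forall b : 'rV[R]_n, b \in B -> ~ even_exponent b)
    (AB_disjoint : (A `&` B)%fset = fset0)
    (c : 'rV[R]_n -> R) (c_supp : supported (A `|` B)%fset c)
    (arr : circuit R n -> seq (option 'rV[R]_n))
    (arrP : forall q : circuit R n, q \in reduced_circuits A (A `|` B)%fset ->
       perm_eq (arr q) (labels q)) :
  S_cone A B c <->
  exists (cc : circuit R n -> 'rV[R]_n -> R)
         (xb : circuit R n -> R) (x : circuit R n -> nat -> nat -> R),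
    [/\ forall q : circuit R n, q \in reduced_circuits A (A `|` B)%fset ->
          supported (q.2 |` q.1)%fset (cc q),
        forall g : 'rV[R]_n, g \notin uncovered A B ->
          c g = \sum_(q <- reduced_circuits A (A `|` B)%fset) cc q g,
        forall a : 'rV[R]_n, a \in uncovered A B -> 0 <= c a &
        forall q : circuit R n, q \in reduced_circuits A (A `|` B)%fset ->
          let m := depth q in
          [/\ forall k i : nat, (2 <= k <= m)%N -> (1 <= i <= 2 ^ (m - k))%N ->
                psd (sym2 (x q k.-1 (2 * i).-1) (x q k i)
                          (x q k.-1 (2 * i)%N)),
              0 <= x q m 1%N - Lambda q * xb q,
              0 <= xb q + cc q q.2,
              q \in reduced_circuits A B -> `|cc q q.2| <= xb q &
              forall l : nat, (1 <= l <= 2 ^ m.-1)%N ->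
                psd (sym2
                  (label_value q (cc q) (xb q) (nth None (arr q) (2 * l).-2))
                  (x q 1%N l)
                  (label_value q (cc q) (xb q) (nth None (arr q) (2 *
                    l).-1)))]].
Proof.
split=> [/(S_cone_soc_cone A_rational B_natural B_noteven AB_disjoint arrP)|].
- move=> [cc [h1 h2 h3]].
  (* Chooses the auxiliary variables of all circuits simultaneously, with zeros for pairs that are
     not reduced circuits. *)
  have /choice[X hX] : forall q, exists X : R * (nat -> nat -> R),
      q \in reduced_circuits A (A `|` B)%fset ->
      circuit_soc A B q (arr q) (cc q) X.1 X.2.
    move=> q; have [/h1[_ [xb [x hx]]]|_] := boolP (q \in reduced_circuits A (A
      `|` B)%fset).
      by exists (xb, x).
    by exists (0, fun _ _ => 0).
  exists cc, (fun q => (X q).1), (fun q => (X q).2); split=> // q qRC.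
    by case: (h1 q qRC).
- move=> [cc [xb [x [h1 h2 h3 h4]]]].
  apply: (soc_cone_S_cone A_rational B_natural AB_disjoint arrP).
  exists cc; split=> // q qRC; split; first exact: h1.
  exists (xb q), (x q); exact: h4.
Qed.
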